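(* Let $n\ge2$ and $Q=n+2$ (so $Q\geq 4$). For all $u\in C_c^\infty(\mathbb{R}^{n+1} \setminus \{o\})$, $$\int_{\mathbb{R}^{n+1}}\frac{|\mathcal{L}_{G} u|^2}{|\nabla_G \varrho|^2}\,dx\,dt= \int_{\mathbb{R}^{n+1}}\frac{|\mathcal{L}_{\varrho,G} u|^2}{|\nabla_G \varrho|^2}\,dx\,dt +\int_{\mathbb{R}^{n+1}}\frac{\left|\sum_{j=1}^{n+1}L_j^2 u\right|^2}{|\nabla_G \varrho|^2}\,dx\,dt +\frac{Q(Q-4)}{2}\sum_{j=1}^{n+1}\int_{\mathbb{R}^{n+1}}\frac{|L_j u|^2}{\varrho^2}\,dx\,dt+2\sum_{j=1}^{n+1}\int_{\mathbb{R}^{n+1}}\varrho^{2-Q}\left|\frac{\partial}{\partial \varrho}\left(\varrho^{\frac{Q-2}{2}}\,L_ju\right)\right|^2\,dx\,dt.$$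
   Context: Grushin space: $n\ge 2$ is an integer and $Q=n+2$ (homogeneous dimension). Points of $\mathbb{R}^{n+1}$ are written $(x,t)$ with $x\in\mathbb{R}^n$, $t\in\mathbb{R}$; $o$ is the origin; all functions are real-valued. The Grushin gradient is $\nabla_G u=(\nabla_x u,\ |x|\partial_t u)$ and the Grushin operator is $\mathcal{L}_G=\Delta_x+|x|^2\partial_t^2$. The homogeneous norm is $\varrho(x,t)=(|x|^4+4t^2)^{1/4}$; it satisfies $|\nabla_G\varrho|^2=|x|^2/\varrho^2=:\psi$ away from $o$. The radial derivative (derivative in $\varrho$ in the polar coordinates $x=\varrho\sin^{1/2}\phi\, w$, $t=\frac{\varrho^2}{2}\cos\phi$, $w\in\mathbb{S}^{n-1}$, $0<\phi<\pi$) is $\frac{\partial}{\partial\varrho}=\frac1\varrho\left(\sum_{j=1}^n x_j\frac{\partial}{\partial x_j}+2t\frac{\partial}{\partial t}\right)$. The radial Grushin operator is $\mathcal{L}_{\varrho,G}=\psi\left\{\frac{\partial^2}{\partial\varrho^2}+\frac{Q-1}{\varrho}\frac{\partial}{\partial\varrho}\right\}$. The spherical vector fields are $$L_j=\frac{\partial}{\partial x_j}-\frac{\partial\varrho}{\partial x_j}\frac{\partial}{\partial \varrho}\ (j=1,\dots,n),\qquad L_{n+1}=|x|\frac{\partial}{\partial t}-|x|\frac{\partial\varrho}{\partial t}\frac{\partial}{\partial \varrho},$$ where $\frac{\partial\varrho}{\partial x_j}=\frac{x_j|x|^2}{\varrho^3}$ and $\frac{\partial\varrho}{\partial t}=\frac{2t}{\varrho^3}$.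 In the claim, $L_ju\,\varrho^{(Q-2)/2}$ means the product of $L_ju$ with $\varrho^{(Q-2)/2}$. Integrals of nonnegative functions may take the value $+\infty$. *)

(* Defs.v *)
From HB Require Import structures.
From mathcomp Require Import all_boot all_order all_algebra.
From mathcomp Require Import all_classical all_reals all_analysis.

Set Implicit Arguments.
Unset Strict Implicit.
Unset Printing Implicit Defensive.

Import Order.TTheory GRing.Theory Num.Theory.
Import numFieldNormedType.Exports.

Local Open Scope classical_set_scope.
Local Open Scope ring_scope.

(** * Lebesgue measure on R^n and integration over R^(n+1) *)

Section tuple_cons_measure.
Context (R : realType) (n : nat).
Variable mu : {sigma_finite_measure set (n.-tuple (measurableTypeR R)) -> \bar R}.

Let tcons (z : measurableTypeR R * n.-tuple (measurableTypeR R)) :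
  n.+1.-tuple (measurableTypeR R) := [the n.+1.-tuple _ of z.1 :: z.2].

Let measurable_tcons : measurable_fun setT tcons.
Proof. exact: measurable_cons. Qed.

(* The product of the one-dimensional Lebesgue measure with [mu], transported
   along the bijection between R * R^n and R^(n+1). *)
Definition cons_measure : set (n.+1.-tuple (measurableTypeR R)) -> \bar R :=
  pushforward (@lebesgue_measure R \x mu)%E tcons.

Let cons_measure0 : cons_measure set0 = 0%E.
Proof. by rewrite /cons_measure /pushforward preimage_set0 measure0. Qed.

Let cons_measure_ge0 A : (0 <= cons_measure A)%E.
Proof. exact: measure_ge0. Qed.

Let cons_measure_semi_sigma_additive : semi_sigma_additive cons_measure.
Proof.
move=> F mF tF mUF; rewrite /cons_measure /pushforward preimage_bigcup.
apply: measure_semi_sigma_additive.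
- by move=> k; rewrite -[X in measurable X]setTI; exact: measurable_tcons.
- apply/trivIsetP => /= i j _ _ ij; rewrite -preimage_setI.
  by move/trivIsetP : tF => /(_ _ _ _ _ ij) ->//; rewrite preimage_set0.
- by rewrite -preimage_bigcup -[X in measurable X]setTI; exact: measurable_tcons.
Qed.

HB.instance Definition _ := isMeasure.Build _ _ _ cons_measure
  cons_measure0 cons_measure_ge0 cons_measure_semi_sigma_additive.

(* Proved by hand: the library declares this for [\x], but the instance that it
   declares for subprobabilities takes its place in canonical inference. *)
Let product_sigma_finite : sigma_finite setT (@lebesgue_measure R \x mu)%E.
Proof.
have /sigma_finiteP[F [TF ndF Foo]] := sigma_finiteT (@lebesgue_measure R).
have /sigma_finiteP[G [TG ndG Goo]] := sigma_finiteT mu.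
exists (fun k => F k `*` G k).
  rewrite -setXTT TF TG predeqE => -[x y]; split.
    move=> [/= [k _ Fkx] [l _ Gly]]; exists (maxn k l) => //; split.
    - by move: x Fkx; exact/subsetPset/ndF/leq_maxl.
    - by move: y Gly; exact/subsetPset/ndG/leq_maxr.
  by move=> [k _ []/= ? ?]; split; exists k.
move=> k; have [? ?] := Foo k; have [? ?] := Goo k.
split; first exact: measurableX.
by rewrite product_measure1E// lte_mul_pinfty// ge0_fin_numE.
Qed.

Let cons_measure_sigma_finite : sigma_finite setT cons_measure.
Proof.
have [F FT Foo] := product_sigma_finite.
pose split_cons (s : n.+1.-tuple (measurableTypeR R)) :
  measurableTypeR R * n.-tuple (measurableTypeR R) :=
  (tnth s ord0, [tuple of behead s]).
have msplit : measurable_fun setT split_cons.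
  apply: measurable_fun_pair; first exact: measurable_tnth.
  exact: measurable_behead.
have consK : cancel tcons split_cons.
  move=> [a s]; rewrite /split_cons /tcons /=; congr (_, _).
  exact/val_inj.
exists (fun k => split_cons @^-1` F k).
  by rewrite -preimage_bigcup -FT preimage_setT.
move=> k; have [mFk Fkoo] := Foo k; split.
  by rewrite -[X in measurable X]setTI; exact: msplit.
rewrite /cons_measure /pushforward -comp_preimage.
by rewrite (_ : split_cons \o tcons = id)//; apply/funext => z /=; rewrite consK.
Qed.

HB.instance Definition _ := Measure_isSigmaFinite.Build _ _ _ cons_measure
  cons_measure_sigma_finite.

End tuple_cons_measure.

Fixpoint lebesgue_tuple (R : realType) (n : nat) :
    {sigma_finite_measure set (n.-tuple (measurableTypeR R)) -> \bar R} :=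
  match n with
  | 0%N => \d_ [tuple of [::]]
  | n'.+1 => cons_measure (lebesgue_tuple R n')
  end.

Section grushin.
Context {R : realType} {n : nat}.

(* R^(n+1) is ['rV[R]_n * R], with points written (x, t).  The norm that the
   library puts on this type is a sup norm; it is used only through the topology
   and the derivatives that it induces. *)
Implicit Types (f u : 'rV[R]_n * R -> R) (z : 'rV[R]_n * R).

Definition integral_space f : \bar R :=
  (\int[lebesgue_tuple R n \x @lebesgue_measure R]_p
     (f (\row_(i < n) tnth p.1 i, p.2))%:E)%E.

(** * Smooth functions with compact support in R^(n+1) \ {o} *)

(* C^oo: every iterated directional derivative is Frechet differentiable. *)
Definition smooth u : Prop :=
  forall (vs : seq ('rV[R]_n * R)) z,
    differentiable (foldr (fun v f => fun z' => 'D_v f z') u vs) z.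

Definition tsupport u : set ('rV[R]_n * R) := closure [set z | u z != 0].

Definition test_function u : Prop :=
  [/\ smooth u, compact (tsupport u) & ~ tsupport u 0].

(** * Grushin geometry *)

Definition hdim : R := (n + 2)%:R.

(* Euclidean norms (not the norm [`|x|] of the library). *)
Definition enorm (x : 'rV[R]_n) : R := Num.sqrt (\sum_(j < n) x 0 j ^+ 2).

Definition enorm1 z : R := Num.sqrt (enorm z.1 ^+ 2 + z.2 ^+ 2).

Definition dx (j : 'I_n) f z : R := 'D_(delta_mx 0 j, 0) f z.

Definition dt f z : R := 'D_(0, 1) f z.

Definition gradG f z : 'rV[R]_n * R :=
  (\row_(j < n) dx j f z, enorm z.1 * dt f z).

Definition LG f z : R :=
  \sum_(j < n) dx j (dx j f) z + enorm z.1 ^+ 2 * dt (dt f) z.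

Definition rho z : R := (enorm z.1 ^+ 4 + 4 * z.2 ^+ 2) `^ (4^-1).

(* [psi] and |grad_G rho|^2 vanish on the Lebesgue-null set {x = 0} (n >= 1),
   where a quotient by them is 0 by the convention [0^-1 = 0]. *)
Definition psi z : R := enorm z.1 ^+ 2 / rho z ^+ 2.

Definition drho f z : R :=
  (rho z)^-1 * (\sum_(j < n) z.1 0 j * dx j f z + 2 * z.2 * dt f z).

Definition LrhoG f z : R :=
  psi z * (drho (drho f) z + (hdim - 1) / rho z * drho f z).

(* The index [j < n] gives the x_j field, and the last index [ord_max] the
   t field. *)
Definition Lsph (j : 'I_n.+1) f z : R :=
  match unlift ord_max j with
  | Some i => dx i f z - dx i rho z * drho f z
  | None => enorm z.1 * dt f z - enorm z.1 * dt rho z * drho f z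
  end.

End grushin.

Arguments hdim : clear implicits.

(* Main.v *)
Require Import Defs.
From HB Require Import structures.
From mathcomp Require Import all_boot all_order all_algebra.
From mathcomp Require Import all_classical all_reals all_analysis.
From mathcomp Require Import measurable_realfun ring lra.

(** Write [Q = n + 2] and let [E = sum_j d_j y_j P_j] generate the anisotropic dilations,
    where [P_j] is the [j]th coordinate derivative, [y_j] the coordinate and [d_j] its
    weight: 1 for the [x_j] and 2 for [t].  Let [m_j] be 1 for the [x_j] and [|x|^2] for
    [t].  Put [v_j = P_j u - c_j E u], the tangential part of the gradient, so that
    [L_j u = m_j^(1/2) v_j], then [F = rho^-2 (E E u + (Q - 2) E u)] and
    [B = sum_j m_j P_j v_j].  One finds that [psi F] is the radial Grushin operator, that
    [B = sum_j L_j^2 u] and that [L_G u = B + psi F].  Hence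
    [|L_G u|^2 / psi = psi F^2 + B^2 / psi + 2 F B] off the null set [x = 0].  Commuting
    [P_j] with [E] shows that [2 F B] is the sum of the integrands of the last two terms
    and of the divergence of an explicit compactly supported C^1 vector field, whose
    integral vanishes by Fubini and the fundamental theorem of calculus.  For [n = 2] the
    integral of [B^2 / psi] may be infinite; only the divergence, which is integrable,
    changes sign. *)

Set Implicit Arguments.
Unset Strict Implicit.
Unset Printing Implicit Defensive.

Import Order.TTheory GRing.Theory Num.Theory.
Import numFieldNormedType.Exports.

Local Open Scope classical_set_scope.
Local Open Scope ring_scope.

(** * Functions with derivatives of all orders on an open set *)

Section calculus.
Context {R : realType} {V : normedModType R}.
Implicit Types (f g : V -> R) (A B : set V) (v w z : V).

(** The [v_j] are used instead of the [L_j] because [|x|], the factor of [L_(n+1)], is not smooth on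
    [x = 0]; the weights [m_j] are polynomials, so the divergence identity relates smooth functions
    on the whole punctured space. Likewise [E] is used instead of the radial derivative: its
    coefficients are polynomials, and differentiating a homogeneous coefficient along it only
    multiplies it by its degree. Moving [P_j] from [v_j] to [F] in [2 F B] leaves
    [-2 sum_j m_j v_j P_j F]. The radial part of [P_j F] drops out, since [m_j c_j] is [d_j y_j]
    times a factor common to all [j] and [sum_j d_j y_j v_j = 0]. The tangential part is [rho^-2]
    times a quadratic polynomial in [E] applied to [v_j], by the commutator of [P_j] and [E]. A
    second integration by parts, along [E], whose divergence is [Q = sum_j d_j], turns the result
    into squares. *)

Lemma is_derive_line f a v h :
  derivable f (h *: v + a) v ->
  is_derive h 1 (fun x : R => f (x *: v + a)) ('D_v f (h *: v + a)).
Proof.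
move=> df.
have E : (fun k : R => k^-1 *: (((fun x : R => f (x *: v + a)) \o shift h)
     (k *: 1) - f (h *: v + a))) =
   (fun k => k^-1 *: ((f \o shift (h *: v + a)) (k *: v) - f (h *: v + a))).
  by apply/funext => k /=; rewrite scalerDl addrA [_%:A]mulr1.
by split; [rewrite /derivable E|rewrite /derive E].
Qed.

Lemma near_derive A f g v z : open A -> (forall x, A x -> f x = g x) ->
  A z -> 'D_v f z = 'D_v g z.
Proof.
move=> oA fg Az; apply: near_eq_derive; near=> x; apply: fg.
by near: x; exact: open_nbhs_nbhs.
Unshelve. all: by end_near. Qed.

(** The first-order expansion of [f] at [z] is also one of [g], and uniqueness of the differential
    identifies ['d g z] with ['d f z]. *)
Lemma near_differentiable A f g z : open A -> (forall x, A x -> f x = g x) ->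
  A z -> differentiable f z -> differentiable g z.
Proof.
move=> oA fg Az df.
have nfg : \forall h \near (0 : V), f (h + z) = g (h + z).
  have : \forall x \near z, f x = g x.
    by near=> x; apply: fg; near: x; exact: open_nbhs_nbhs.
  by rewrite (near_shift 0)/=; apply: filterS => h; rewrite /= subr0.
have E : g \o shift z = cst (g z) + 'd f z +o_ 0 id.
  apply/eqaddoP => e e0.
  have /eqaddoP/(_ e e0) := diff_locally df.
  rewrite /= !near_simpl; apply: filterS2 nfg => h fgh.
  rewrite -(fg z Az) /=.
  have subE (F G : V -> R) : (F - G) h = F h - G h by [].
  by rewrite !subE /= fgh.
have dE : 'd g z = 'd f z :> (V -> R).
  by apply: diff_unique => //; exact: diff_continuous df.
by apply/diff_locallyP; rewrite dE; split => //; exact: diff_continuous df.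
Unshelve. all: by end_near. Qed.

Lemma derive_eq0 f v z : (forall h : R, f (h *: v + z) = f z) -> 'D_v f z = 0.
Proof.
move=> fz; rewrite /derive.
rewrite (_ : (fun _ => _) = cst 0) ?lim_cst//.
by apply/funext => h /=; rewrite fz subrr scaler0.
Qed.

(** Counting the order turns closure under products and powers into an induction on [k]. The lists
    of directions in [smooth] do not suit this, since the derivative of a product is a sum of two
    products. *)
Fixpoint smooth_upto A k f : Prop :=
  (forall z, A z -> differentiable f z) /\
  (if k is k'.+1 then forall v, smooth_upto A k' ('D_v f) else True).

Definition smooth_on A f := forall k, smooth_upto A k f.

Lemma smooth_upto_diff A k f z : smooth_upto A k f -> A z -> differentiable f z.
Proof. by case: k => [|k] [+ _]; apply. Qed.

Lemma smooth_uptoS A k f : smooth_upto A k.+1 f -> smooth_upto A k f.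
Proof.
elim: k f => [f [df _]//|k IH f [df Df]]; split=> // v; exact/IH/Df.
Qed.

Lemma smooth_upto_ext A k f g : open A -> (forall z, A z -> f z = g z) ->
  smooth_upto A k f -> smooth_upto A k g.
Proof.
move=> oA; elim: k f g => [|k IH] f g fg [df Df]; split=> //.
- by move=> z Az; exact: near_differentiable oA fg Az (df _ Az).
- by move=> z Az; exact: near_differentiable oA fg Az (df _ Az).
- by move=> v; apply: IH (Df v) => z Az; exact: near_derive oA fg Az.
Qed.

Lemma smooth_upto_cst A k (c : R) : smooth_upto A k (fun=> c).
Proof.
elim: k c => [|k IH] c; split=> // v.
rewrite (_ : 'D_v _ = fun=> 0); first exact: IH.
by apply/funext => z; exact: derive_cst.
Qed.

Lemma smooth_uptoD A k f g : open A ->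
  smooth_upto A k f -> smooth_upto A k g -> smooth_upto A k (fun z => f z + g z).
Proof.
move=> oA; elim: k f g => [|k IH] f g [df Df] [dg Dg]; split=> //.
- by move=> z Az; apply: differentiableD; [exact: df|exact: dg].
- by move=> z Az; apply: differentiableD; [exact: df|exact: dg].
- move=> v; apply: smooth_upto_ext (IH _ _ (Df v) (Dg v)) => // z Az.
  symmetry; apply: deriveD; apply: diff_derivable; [exact: df|exact: dg].
Qed.

Lemma deriveM_fun f g v z : derivable f z v -> derivable g z v ->
  'D_v (fun x => f x * g x) z = 'D_v f z * g z + f z * 'D_v g z.
Proof.
move=> df dg; have /= E := deriveM df dg.
by rewrite [LHS]E addrC mulrC.
Qed.

Lemma smooth_uptoM A k f g : open A ->
  smooth_upto A k f -> smooth_upto A k g -> smooth_upto A k (fun z => f z * g z).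
Proof.
move=> oA; elim: k f g => [|k IH] f g sf sg; split=> //.
- by move=> z Az; apply: differentiableM;
    [exact: smooth_upto_diff sf Az|exact: smooth_upto_diff sg Az].
- by move=> z Az; apply: differentiableM;
    [exact: smooth_upto_diff sf Az|exact: smooth_upto_diff sg Az].
- move=> v; have [df Df] := sf; have [dg Dg] := sg.
  apply: (@smooth_upto_ext _ _ (fun z => 'D_v f z * g z + f z * 'D_v g z)) => //.
    move=> z Az; symmetry.
    by apply: deriveM_fun; apply: diff_derivable; [exact: df _ Az|exact: dg _ Az].
  by apply: smooth_uptoD => //; apply: IH;
    [exact: Df|exact: smooth_uptoS|exact: smooth_uptoS|exact: Dg].
Qed.

Lemma differentiable_powR f a z : 0 < f z -> differentiable f z ->
  differentiable (fun x => f x `^ a) z.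
Proof.
move=> f0 df; have dp : differentiable (fun y : R => y `^ a) (f z).
  by apply/derivable1_diffP; apply: ex_derive; exact: is_derive1_powR.
exact: (differentiable_comp df dp).
Qed.

Lemma derive_powR f a v z : 0 < f z -> differentiable f z ->
  'D_v (fun x => f x `^ a) z = a * f z `^ (a - 1) * 'D_v f z.
Proof.
move=> f0 df.
have dp : derivable (fun y : R => y `^ a) (f z) 1.
  by apply: ex_derive; exact: is_derive1_powR.
have dp' : differentiable (fun y : R => y `^ a) (f z) by exact/derivable1_diffP.
rewrite deriveE; last exact: differentiable_powR.
have -> : (fun x => f x `^ a) = (fun y : R => y `^ a) \o f by [].
rewrite diff_comp//= -(deriveE v df) deriv1E// derive1E.
have [_ ->] := is_derive1_powR a f0.
exact: mulrC.
Qed.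

Lemma smooth_upto_powR A k f a : open A -> (forall z, A z -> 0 < f z) ->
  smooth_upto A k f -> smooth_upto A k (fun z => f z `^ a).
Proof.
move=> oA f0; elim: k f a f0 => [|k IH] f a f0 sf; split=> //.
- by move=> z Az; apply: differentiable_powR;
    [exact: f0|exact: smooth_upto_diff sf Az].
- by move=> z Az; apply: differentiable_powR;
    [exact: f0|exact: smooth_upto_diff sf Az].
- move=> v; have [df Df] := sf.
  apply: (@smooth_upto_ext _ _ (fun z => a * f z `^ (a - 1) * 'D_v f z)) => //.
    by move=> z Az; rewrite derive_powR//; [exact: f0 _ Az|exact: df _ Az].
  apply: smooth_uptoM => //; last exact: Df.
  apply: smooth_uptoM => //; first exact: smooth_upto_cst.
  by apply: IH => //; exact: smooth_uptoS sf.
Qed.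

Lemma smooth_on_diff A f z : smooth_on A f -> A z -> differentiable f z.
Proof. by move=> /(_ 0%N)[+ _]; apply. Qed.

Lemma smooth_on_derivable A f v z : smooth_on A f -> A z -> derivable f z v.
Proof. by move=> sf Az; exact/diff_derivable/(smooth_on_diff sf Az). Qed.

Lemma smooth_onP A f : smooth_on A f <-> forall (vs : seq V) z, A z ->
  differentiable (foldr (fun v g => fun z' => 'D_v g z') f vs) z.
Proof.
have aux k g : smooth_upto A k g <-> forall (vs : seq V) z, (size vs <= k)%N ->
    A z -> differentiable (foldr (fun v g => fun z' => 'D_v g z') g vs) z.
  elim: k g => [|k IH] g; split.
  - by move=> [dg _] [|//] z _; exact: dg.
  - by move=> dg; split=> // z; exact: (dg [::]).
  (* The fold differentiates first along the last direction of the list, so the list is split at its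
     end. *)
  - move=> [dg Dg] vs z; elim/last_ind: vs => [_|vs v _]; first exact: dg.
    by rewrite size_rcons foldr_rcons => vsk; exact: ((IH _).1 (Dg v)).
  - move=> dg; split=> [z|v]; first exact: (dg [::]).
    apply/IH => vs z vsk Az.
    by have := dg (rcons vs v) z; rewrite foldr_rcons size_rcons; exact.
split=> [sf vs z Az|sf k]; last by apply/aux => vs z _; exact: sf.
by have /aux := sf (size vs); exact.
Qed.

Lemma smooth_on_ext A f g : open A -> (forall z, A z -> f z = g z) ->
  smooth_on A f -> smooth_on A g.
Proof. by move=> oA fg sf k; exact: smooth_upto_ext fg (sf k). Qed.

Lemma smooth_on_sub A B f : B `<=` A -> smooth_on A f -> smooth_on B f.
Proof.
move=> BA sf k; elim: k f sf => [|k IH] f sf; split=> //.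
- by move=> z Bz; exact: smooth_on_diff sf (BA _ Bz).
- by move=> z Bz; exact: smooth_on_diff sf (BA _ Bz).
- by move=> v; apply: IH => k'; have [_] := sf k'.+1; exact.
Qed.

Lemma smooth_on_cst A (c : R) : smooth_on A (fun=> c).
Proof. by move=> k; exact: smooth_upto_cst. Qed.

Lemma smooth_onD A f g : open A -> smooth_on A f -> smooth_on A g ->
  smooth_on A (fun z => f z + g z).
Proof. by move=> oA sf sg k; exact: smooth_uptoD. Qed.

Lemma smooth_onM A f g : open A -> smooth_on A f -> smooth_on A g ->
  smooth_on A (fun z => f z * g z).
Proof. by move=> oA sf sg k; exact: smooth_uptoM. Qed.

Lemma smooth_onB A f g : open A -> smooth_on A f -> smooth_on A g ->
  smooth_on A (fun z => f z - g z).
Proof.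
move=> oA sf sg; apply: (@smooth_on_ext A (fun z => f z + -1 * g z)) => //.
  by move=> z _; rewrite mulN1r.
apply: smooth_onD => //; apply: smooth_onM => //; exact: smooth_on_cst.
Qed.

Lemma smooth_onX A f n : open A -> smooth_on A f ->
  smooth_on A (fun z => f z ^+ n).
Proof.
move=> oA sf; elim: n => [|n IH].
  by apply: (smooth_on_ext oA _ (@smooth_on_cst A 1)) => z _; rewrite expr0.
apply: (smooth_on_ext oA _ (smooth_onM oA sf IH)) => z _.
by rewrite exprS.
Qed.

Lemma smooth_on_powR A f a : open A -> (forall z, A z -> 0 < f z) ->
  smooth_on A f -> smooth_on A (fun z => f z `^ a).
Proof. by move=> oA f0 sf k; exact: smooth_upto_powR. Qed.

Lemma smooth_on_sum A (I : Type) (s : seq I) (P : pred I) (F : I -> V -> R) :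
  open A -> (forall i, smooth_on A (F i)) ->
  smooth_on A (fun z => \sum_(i <- s | P i) F i z).
Proof.
move=> oA sF; elim: s => [|i s IH].
  apply: (smooth_on_ext oA _ (@smooth_on_cst A 0)) => z _; by rewrite big_nil.
apply: (@smooth_on_ext _ (fun z => (P i)%:R * F i z +
    \sum_(j <- s | P j) F j z)) => //.
  by move=> z _; rewrite big_cons; case: (P i); rewrite ?mul1r ?mul0r ?add0r.
by apply: smooth_onD => //; apply: smooth_onM => //; exact: smooth_on_cst.
Qed.

Lemma smooth_on_derive A f v : smooth_on A f -> smooth_on A ('D_v f).
Proof. by move=> sf k; have [_] := sf k.+1; exact. Qed.

Lemma smooth_on_continuous A f z : smooth_on A f -> A z -> {for z, continuous f}.
Proof.
by move=> sf Az; exact: differentiable_continuous (smooth_on_diff sf Az).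
Qed.

Lemma mean_value_line f a v h : 0 < h ->
  (forall x, 0 <= x <= h -> derivable f (x *: v + a) v) ->
  exists2 x, 0 <= x <= h & f (h *: v + a) - f a = 'D_v f (x *: v + a) * h.
Proof.
move=> h0 df.
have [||x] := @MVT R (fun x => f (x *: v + a)) (fun x => 'D_v f (x *: v + a)) 0 h h0.
- move=> x /[!in_itv]/= /andP[x0 xh]; apply: is_derive_line.
  by apply: df; rewrite !ltW.
- apply: derivable_within_continuous => x /[!in_itv]/= x0h.
  by have [] := is_derive_line (df x x0h).
- rewrite in_itv/= => /andP[x0 xh]; rewrite scale0r add0r subr0 => E.
  by exists x => //; rewrite !ltW.
Qed.

Lemma eq_near_eq (g1 g2 : V -> R) z :
  {for z, continuous g1} -> {for z, continuous g2} ->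
  (forall d : R, 0 < d -> exists x y, [/\ ball z d x, ball z d y & g1 x = g2 y]) ->
  g1 z = g2 z.
Proof.
move=> c1 c2 g12; apply/eqP; rewrite -subr_eq0 -normr_le0.
apply/ler_addgt0Pr => e e0; rewrite add0r.
have e20 : 0 < e / 2 by rewrite divr_gt0.
move: c1 => /cvgrPdist_lt/(_ _ e20)/nbhs_ballP[d1 /= d10 B1].
move: c2 => /cvgrPdist_lt/(_ _ e20)/nbhs_ballP[d2 /= d20 B2].
have d0 : 0 < Num.min d1 d2 by rewrite lt_min d10.
have [x [y [bx by_ E]]] := g12 _ d0.
have m1 : Num.min d1 d2 <= d1 by rewrite ge_min lexx.
have m2 : Num.min d1 d2 <= d2 by rewrite ge_min lexx orbT.
have {}B1 := B1 x (le_ball m1 bx).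
have {}B2 := B2 y (le_ball m2 by_).
rewrite -(subrKA (g1 x)) (le_trans (ler_normD _ _))// [leRHS]splitr.
by rewrite lerD ?ltW// E distrC.
Qed.

(* Both mixed derivatives are, at points arbitrarily close to [z], the quotient by
   [h ^+ 2] of the second difference of [f] along [h *: v] and [h *: w]. *)
Lemma derive_comm A f v w z : open A -> smooth_on A f -> A z ->
  'D_v ('D_w f) z = 'D_w ('D_v f) z.
Proof.
move=> oA sf Az.
have mixed (g : V -> R) (a b : V) (h : R) : smooth_on A g -> 0 < h ->
    (forall x y, 0 <= x <= h -> 0 <= y <= h -> A (x *: a + (y *: b + z))) ->
    exists x y, [/\ 0 <= x <= h, 0 <= y <= h &
      g (h *: a + (h *: b + z)) - g (h *: a + z) - (g (h *: b + z) - g z) =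
      'D_b ('D_a g) (x *: a + (y *: b + z)) * (h * h)].
  move=> sg h0 Ah.
  have h00 : 0 <= (0 : R) <= h by rewrite lexx ltW.
  have hh : 0 <= h <= h by rewrite lexx ltW.
  (* The second difference is the increment of [G] along [h *: a]. The mean value theorem is applied
     to [G] along [a], then to ['D_a g] along [b]. *)
  pose G x := g (h *: b + x) - g x.
  have dg y x : 0 <= y <= h -> 0 <= x <= h ->
      derivable g (x *: a + (y *: b + z)) a.
    by move=> yh xh; apply: (smooth_on_derivable sg); exact: Ah.
  have dS x : 0 <= x <= h ->
      is_derive (x *: a + z) a (fun x => g (h *: b + x))
        ('D_a g (h *: b + (x *: a + z))).
    move=> xh; rewrite (_ : (fun x => _) = g \o +%R (h *: b))//.
    have E : (fun k : R => k^-1 *: (((g \o +%R (h *: b)) \o shift (x *: a + z))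
       (k *: a) - (g \o +%R (h *: b)) (x *: a + z))) =
       (fun k => k^-1 *: ((g \o shift (h *: b + (x *: a + z))) (k *: a)
         - g (h *: b + (x *: a + z)))).
      by apply/funext => k /=; rewrite addrCA.
    split; [rewrite /derivable E|by rewrite /derive E].
    by rewrite addrCA; exact: dg.
  have dG x : 0 <= x <= h -> is_derive (x *: a + z) a G
      ('D_a g (h *: b + (x *: a + z)) - 'D_a g (x *: a + z)).
    move=> xh; apply: is_deriveB; first exact: dS.
    apply: derivableP; have := dg 0 x h00 xh.
    by rewrite scale0r add0r.
  have [x xh Ex] : exists2 x, 0 <= x <= h &
      G (h *: a + z) - G z = 'D_a G (x *: a + z) * h.
    by apply: mean_value_line => // x xh; have [] := dG x xh.
  have [y yh Ey] : exists2 y, 0 <= y <= h &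
    'D_a g (h *: b + (x *: a + z)) - 'D_a g (x *: a + z) =
      'D_b ('D_a g) (y *: b + (x *: a + z)) * h.
    apply: (@mean_value_line ('D_a g) _ b h h0) => y yh; rewrite addrCA.
    by apply: (smooth_on_derivable (smooth_on_derive a sg)); exact: Ah.
  exists x, y; split => //.
  have [_ DG] := dG x xh.
  move: Ex; rewrite DG Ey -mulrA (addrCA (y *: b)) => <-.
  by rewrite /G (addrCA (h *: b)); ring.
apply: (eq_near_eq (smooth_on_continuous (smooth_on_derive v (smooth_on_derive w sf))
  Az)
  (smooth_on_continuous (smooth_on_derive w (smooth_on_derive v sf)) Az)) => d d0.
have /nbhs_ballP[d1 /= d10 Bd] : nbhs z (A `&` ball z d).
  by apply: filterI; [exact: open_nbhs_nbhs|exact: nbhsx_ballx].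
(* With [h * c = d1 / 2], the parallelogram at [z] with sides [h *: v] and [h *: w] stays in the
   ball of radius [d1]; the summand 1 keeps [c] positive when both directions vanish. *)
pose c := `|v| + `|w| + 1.
have c0 : 0 < c by rewrite ltr_wpDl// addr_ge0.
pose h := d1 / 2 / c.
have h0 : 0 < h by rewrite divr_gt0// divr_gt0.
have near_z (a b : V) x y : `|a| + `|b| + 1 = c -> 0 <= x <= h -> 0 <= y <= h ->
    ball z d1 (x *: a + (y *: b + z)).
  move=> abc /andP[x0 xh] /andP[y0 yh]; rewrite -ball_normE/= addrA.
  rewrite opprD addrCA subrr addr0 normrN (le_lt_trans (ler_normD _ _))//.
  rewrite !normrZ !ger0_norm//.
  apply: (@le_lt_trans _ _ (h * c)).
    rewrite -abc mulrDr mulrDr mulr1 -[leLHS]addr0.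
    apply: lerD; last exact: ltW.
    by apply: lerD; rewrite ler_wpM2r.
  by rewrite /h divfK ?gt_eqF// ltr_pdivrMr// ltr_pMr// ltr1n.
have near_vw x y : 0 <= x <= h -> 0 <= y <= h -> ball z d1 (x *: v + (y *: w + z)).
  exact: near_z.
have near_wv x y : 0 <= x <= h -> 0 <= y <= h -> ball z d1 (x *: w + (y *: v + z)).
  by apply: near_z; rewrite /c (addrC `|w|).
have [|x1 [y1 [x1h y1h E1]]] := mixed f v w h sf h0.
  by move=> x y xh yh; have [] := Bd _ (near_vw _ _ xh yh).
have [|x2 [y2 [x2h y2h E2]]] := mixed f w v h sf h0.
  by move=> x y xh yh; have [] := Bd _ (near_wv _ _ xh yh).
exists (x2 *: w + (y2 *: v + z)), (x1 *: v + (y1 *: w + z)); split.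
- by have [] := Bd _ (near_wv _ _ x2h y2h).
- by have [] := Bd _ (near_vw _ _ x1h y1h).
- have hh0 : h * h != 0 by rewrite mulf_neq0 ?gt_eqF.
  apply: (mulIf hh0); refine (etrans (esym E2) (etrans _ E1)).
  rewrite (addrCA (h *: w)); ring.
Qed.

End calculus.

(** * Lebesgue measure on tuples *)

Section integration.
Context {R : realType}.
Local Notation mR := (measurableTypeR R).
Local Notation leb := (@lebesgue_measure R).

Definition point {n} (p : n.-tuple mR * mR) : 'rV[R]_n * R :=
  (\row_(i < n) tnth p.1 i, p.2).

Lemma big_setI_ord (T : Type) n (F : 'I_n -> set T) :
  \big[setI/setT]_(i < n) F i = [set x | forall i, F i x].
Proof.
apply/seteqP; split => x /=.
  move=> + i; rewrite (bigD1 i)//= => -[]//.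
by move=> Fx; elim/big_ind : _ => // A B Ax Bx; split.
Qed.

(** The norm is a sup norm, so the ball is a finite intersection of conditions on single
    coordinates. *)
Lemma point_ball_measurable n (c : 'rV[R]_n * R) (e : R) :
  measurable (point @^-1` ball c e).
Proof.
have [e0|e0] := ltP 0 e; last first.
  rewrite (_ : _ @^-1` _ = set0)//; apply/seteqP; split=> // p /=.
  by rewrite -ball_normE/= => /(le_lt_trans (normr_ge0 _)); rewrite ltNge e0.
have -> : point @^-1` ball c e =
   (\big[setI/setT]_(i < n)
      ((fun p : n.-tuple mR * mR => tnth p.1 i) @^-1` ball (c.1 0 i) e))
   `&` (snd @^-1` ball c.2 e).
  rewrite big_setI_ord.
  apply/seteqP; split=> [p [[_ /= B1] B2]|p [B1 B2]]; split=> //=.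
    by move=> i; have := B1 0 i; rewrite mxE.
  by split=> // i j; rewrite ord1 mxE; exact: B1.
apply: measurableI; last first.
  by rewrite -[X in measurable X]setTI; apply: measurable_snd => //;
    exact: measurable_ball.
apply: bigsetI_measurable => i _; rewrite -[X in measurable X]setTI.
have m : measurable_fun setT (fun p : n.-tuple mR * mR => tnth p.1 i).
  by apply: (measurableT_comp (measurable_tnth i)) => //; exact: measurable_fst.
by apply: m => //; exact: measurable_ball.
Qed.

Lemma rat_approx (x e : R) : 0 < e -> exists q : rat, `|x - ratr q| < e.
Proof.
move=> e0; have [||y [xy [q _ qy]]] := @dense_rat R (ball x e).
- by exists x; exact: ballxx.
- exact: ball_open.
- by exists q; rewrite qy; move: xy; rewrite -ball_normE.
Qed.

(** The product sigma-algebra is generated by the coordinates, so the open set is written as a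
    countable union of balls with rational centre and radius [1 / (m + 1)]. Indices whose ball
    leaves [U] contribute the empty set. *)
Lemma point_open_measurable n (U : set ('rV[R]_n * R)) : open U ->
  measurable (point @^-1` U).
Proof.
move=> oU.
pose idx := ('rV[rat]_n * rat * nat)%type.
pose B (i : idx) := ball (map_mx ratr i.1.1 : 'rV[R]_n, ratr i.1.2 : R) (i.2.+1%:R^-1).
pose B' (o : option idx) := if o is Some i then
  (if `[< B i `<=` U >] then B i else set0) else set0.
have UE : U = \bigcup_k B' (unpickle k).
  apply/seteqP; split=> [z Uz|z [k _]]; last first.
    by rewrite /B'; case: (unpickle k) => // i; case: asboolP => // BU; exact: BU.
  have /nbhs_ballP[e /= e0 eU] : nbhs z U by exact: open_nbhs_nbhs.
  (* The ball has to contain [z] and stay within distance [e] of it; two radii are added, hence half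
     of [e]. *)
  have [m me] : exists m : nat, m.+1%:R^-1 < e / 2.
    have e20 : 0 < e / 2 by rewrite divr_gt0.
    have [m _ /(_ m (leqnn _)) me] := near_infty_natSinv_lt (PosNum e20).
    by exists m.
  have m0 : 0 < m.+1%:R^-1 :> R by rewrite invr_gt0.
  have [q1 q1P] : exists q : 'I_n -> rat, forall j, `|z.1 0 j - ratr (q j)| <
    m.+1%:R^-1.
    by apply: (@fin_all_exists _ (fun=> rat)
      (fun j q => `|z.1 0 j - ratr q| < m.+1%:R^-1)) => j; exact: rat_approx.
  have [q2 q2P] := rat_approx z.2 m0.
  pose i : idx := (\row_j q1 j, q2, m).
  have Bz : B i z.
    split; first split=> //= k j.
      by rewrite ord1 !mxE /ball/= distrC.
    by rewrite /ball/= distrC.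
  suff BU : B i `<=` U.
    have [k ki] : exists k, unpickle k = Some i.
      by exists (pickle i); exact: pickleK.
    by exists k; [exact: Logic.I|rewrite ki /B' asboolT].
  move=> y By; apply: eU.
  have : ball z (m.+1%:R^-1 + m.+1%:R^-1) y.
    by apply: ball_triangle By; exact: ball_sym.
  by apply: le_ball; rewrite [leRHS]splitr lerD// ltW.
rewrite UE preimage_bigcup; apply: bigcupT_measurable => k.
rewrite /B'; case: (unpickle k) => [i|]; last by rewrite preimage_set0.
by case: asboolP => _; [exact: point_ball_measurable|rewrite preimage_set0].
Qed.

Lemma point_measurable n (f : 'rV[R]_n * R -> R) : continuous f ->
  measurable_fun setT (f \o point).
Proof.
move=> cf; apply: (measurability _ (RGenOInfty.measurableE R)).
move=> _ [_ [a ->] <-]; rewrite setTI comp_preimage.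
apply: point_open_measurable; move/continuousP : cf; apply.
exact: interval_open.
Qed.

Lemma bounded_support_integrable d (T : measurableType d)
    (mu : {measure set T -> \bar R}) (B : set T) (f : T -> R) (C : R) :
  measurable B -> (mu B < +oo)%E -> measurable_fun setT f ->
  (forall x, `|f x| <= C) -> (forall x, ~ B x -> f x = 0) ->
  mu.-integrable setT (EFin \o f).
Proof.
move=> mB muB mf fC f0.
have := @measurable_bounded_integrable _ _ _ mu f B mB muB.
move=> /(_ (measurable_funTS mf)) intB.
have {}intB : mu.-integrable B (EFin \o f).
  apply: intB; exists C; split; first exact: num_real.
  by move=> y Cy x _ /=; rewrite (le_trans (fC x))// ltW.
rewrite (_ : EFin \o f = (EFin \o f) \_ B).
  by apply/integrable_restrict => //; rewrite setTI.
apply/funext => x; rewrite patchE; case: ifPn => // /negP xB /=.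
by rewrite f0// => Bx; apply: xB; exact/mem_set.
Qed.

(** The map along which [cons_measure] pushes the product measure forward; it is local to that
    construction and named again here so that integrals can be transported. *)
Definition tcons n (z : mR * n.-tuple mR) : n.+1.-tuple mR :=
  [the n.+1.-tuple _ of z.1 :: z.2].

Lemma measurable_tcons n : measurable_fun setT (@tcons n).
Proof. exact: measurable_cons. Qed.

Definition box n (M : R) : set (n.-tuple mR) :=
  [set s | forall i, - M <= (tnth s i : R) <= M].

Lemma measurable_box n M : measurable (@box n M).
Proof.
rewrite (_ : box _ = \big[setI/setT]_(i < n)
    ((fun s : n.-tuple mR => tnth s i) @^-1` `[-M, M]%classic)).
  apply: bigsetI_measurable => i _; rewrite -[X in measurable X]setTI.
  exact: measurable_tnth.
rewrite big_setI_ord; apply/seteqP; split=> s /= sM i; have := sM i;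
  by rewrite in_itv.
Qed.

Lemma box_lty n (M : R) : (lebesgue_tuple R n (@box n M) < +oo)%E.
Proof.
elim: n => [|n IH].
  rewrite /= diracE; exact: ltey.
rewrite /= /cons_measure /pushforward.
rewrite (_ : _ @^-1` _ = `[-M, M]%classic `*` @box n M); last first.
  apply/seteqP; split=> [[a s] /= H|[a s] /= [+ sM] i]; rewrite /= in_itv/=.
    split; first by have := H ord0.
    by move=> i; have := H (lift ord0 i); rewrite tnthS.
  move=> aM; have [j ->|->//] := unliftP ord0 i; rewrite tnthS; exact: sM.
rewrite product_measure1E//; last exact: measurable_box.
rewrite lte_mul_pinfty//.
have lebM := @lebesgue_measure_itv R `[-M, M]%R.
suff : leb `[-M, M]%classic \is a fin_num by [].
by rewrite lebM; case: ifPn.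
Qed.

Lemma measurable_tuple_zero n :
  measurable [set s : n.-tuple mR | forall i, (tnth s i : R) = 0].
Proof.
rewrite (_ : mkset _ = \big[setI/setT]_(i < n)
    ((fun s : n.-tuple mR => tnth s i) @^-1` [set 0])).
  apply: bigsetI_measurable => i _; rewrite -[X in measurable X]setTI.
  exact: measurable_tnth.
by rewrite big_setI_ord.
Qed.

(** The condition on the first coordinate alone already gives a factor of measure 0. *)
Lemma tuple_zero_null n : (0 < n)%N ->
  lebesgue_tuple R n [set s | forall i, (tnth s i : R) = 0] = 0%E.
Proof.
case: n => // n _.
rewrite /= /cons_measure /pushforward.
rewrite (_ : _ @^-1` _ = [set 0 : R] `*`
   [set s : n.-tuple mR | forall i, (tnth s i : R) = 0]); last first.
  apply/seteqP; split=> [[a s] /= H|[a s] /= [-> sM] i].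
    split; first by have := H ord0.
    by move=> i; have := H (lift ord0 i); rewrite tnthS.
  by have [j ->|->//] := unliftP ord0 i; rewrite tnthS; exact: sM.
rewrite product_measure1E//; last exact: measurable_tuple_zero.
have leb0 : leb [set 0] = 0%E := lebesgue_measure_set1 0.
by rewrite [X in (X * _)%E]leb0 mul0e.
Qed.

(** A class of integrable functions that is stable under fixing the first coordinate, as the
    induction on the dimension in [integral_tuple_line] requires. *)
Definition boxed n (g : n.-tuple mR -> R) := measurable_fun setT g /\
  exists C M, (forall s, `|g s| <= C) /\ (forall s, ~ box M s -> g s = 0).

Lemma boxed_integrable n (g : n.-tuple mR -> R) : boxed g ->
  (lebesgue_tuple R n).-integrable setT (EFin \o g).
Proof.
move=> [mg [C [M [gC g0]]]].
apply: bounded_support_integrable g0 => //; first exact: measurable_box.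
exact: box_lty.
Qed.

Lemma boxed_tcons_integrable n (g : n.+1.-tuple mR -> R) : boxed g ->
  (leb \x lebesgue_tuple R n)%E.-integrable setT (EFin \o (g \o @tcons n)).
Proof.
move=> bg; have [mg _] := bg.
have /integrableP[_] := boxed_integrable bg.
rewrite /= /cons_measure ge0_integral_pushforward//; last 2 first.
- exact: measurable_tcons.
- by apply/measurable_EFinP; apply: measurableT_comp.
move=> int; apply/integrableP; split => //.
by apply/measurable_EFinP; apply: measurableT_comp => //; exact: measurable_tcons.
Qed.

Lemma integral_tcons n (g : n.+1.-tuple mR -> R) : boxed g ->
  (\int[lebesgue_tuple R n.+1]_s (g s)%:E =
  \int[leb \x lebesgue_tuple R n]_z (g (tcons z))%:E)%E.
Proof.
move=> bg; rewrite /= /cons_measure integral_pushforward//.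
- exact: measurable_tcons.
- by apply/measurable_EFinP; have [] := bg.
- exact: boxed_tcons_integrable.
Qed.

Definition tuple_upd n (s : n.-tuple mR) (j : 'I_n) (a : mR) : n.-tuple mR :=
  [tuple if i == j then a else tnth s i | i < n].

Lemma boxed_slice n (g : n.+1.-tuple mR -> R) a : boxed g ->
  boxed (fun s => g (tcons (a, s))).
Proof.
move=> [mg [C [M [gC g0]]]]; split.
  apply: measurableT_comp mg _.
  exact: (@measurable_cons _ _ (n.-tuple mR) mR (fun=> a) n id).
exists C, M; split=> // s sM; apply: g0 => H; apply: sM => i.
by have := H (lift ord0 i); rewrite tnthS.
Qed.

(** Fubini, with the first coordinate split off. If [j] is that coordinate it becomes the inner
    variable; otherwise the induction hypothesis applies to the slice at a fixed first
    coordinate. *)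
Lemma integral_tuple_line n (j : 'I_n) (g : n.-tuple mR -> R) : boxed g ->
  (forall s, \int[leb]_a (g (tuple_upd s j a))%:E = 0)%E ->
  (\int[lebesgue_tuple R n]_s (g s)%:E = 0)%E.
Proof.
elim: n j g => [[]//|n IH] j g bg line0.
rewrite integral_tcons//.
have [i ji|j0] := unliftP ord0 j.
  rewrite -integral12_prod_meas1; last exact: boxed_tcons_integrable.
  apply: integral0_eq => a _; rewrite /fubini_F.
  apply: (IH i (fun s => g (tcons (a, s)))); first exact: boxed_slice.
  move=> s; rewrite -[RHS](line0 (tcons (a, s))); apply: eq_integral => b _.
  congr (g _)%:E; apply: eq_from_tnth => k; rewrite tnth_mktuple ji.
  have [l ->|->] := unliftP ord0 k.
    by rewrite !tnthS tnth_mktuple (inj_eq (@lift_inj _ _)).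
  by rewrite !tnth0.
rewrite -integral21_prod_meas1; last exact: boxed_tcons_integrable.
apply: integral0_eq => s _; rewrite /fubini_G.
(* The entry 0 is a placeholder that [tuple_upd] overwrites, since [j] is the first index. *)
rewrite -[RHS](line0 (tcons (0, s))); apply: eq_integral => b _.
congr (g _)%:E; apply: eq_from_tnth => k; rewrite tnth_mktuple j0.
have [l ->|->] := unliftP ord0 k; first by rewrite !tnthS.
by rewrite !tnth0 eqxx.
Qed.

End integration.

(** * Integrals of derivatives of compactly supported functions *)

Section compactly_supported.
Context {R : realType}.
Local Notation mR := (measurableTypeR R).
Local Notation leb := (@lebesgue_measure R).

Lemma integral_derive_line (f df : R -> R) (M : R) :
  (forall a : R, is_derive a 1 f (df a)) -> continuous df ->
  (forall a, M < `|a| -> f a = 0) -> (forall a, M < `|a| -> df a = 0) ->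
  (\int[leb]_a (df a)%:E = 0)%E.
Proof.
move=> fdf cdf f0 df0.
(* The absolute value covers a negative [M]: the interval from [-L] to [L] must be nondegenerate,
   with both endpoints beyond [M]. *)
pose L : R := `|M| + 1.
have L0 : 0 < L by rewrite ltr_wpDl.
have ML : M < L by rewrite (le_lt_trans (ler_norm M))// ltrDl.
have cf : continuous f.
  move=> a; apply/differentiable_continuous/derivable1_diffP.
  by have [] := fdf a.
have -> : (\int[leb]_a (df a)%:E = \int[leb]_(a in `[(- L)%R, L]) (df a)%:E)%E.
  rewrite [RHS]integral_mkcond; apply: eq_integral => a _.
  rewrite patchE; case: ifPn => // /negP aL; rewrite df0//.
  rewrite (lt_le_trans ML)// leNgt; apply/negP => aL'; apply: aL.
  by apply/mem_set; rewrite /= in_itv/= -ler_norml ltW.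
rewrite (@continuous_FTC2 _ df f (- L) L).
- by rewrite !f0 ?subee// ?normrN gtr0_norm.
- by rewrite gtrN.
- exact: continuous_subspaceT.
- split=> [x _||]; first by have [] := fdf x.
  + by apply: cvg_at_right_filter; exact: cf.
  + by apply: cvg_at_left_filter; exact: cf.
- by move=> x _; rewrite derive1E; have [_ ->] := fdf x.
Qed.

Section compact_support.
Context {n : nat}.
Local Notation V := ('rV[R]_n * R)%type.
Implicit Types (f : V -> R) (K : set V).

Definition vanishes_off K f := forall z, ~ K z -> f z = 0.

Lemma vanishes_derive K f v : closed K -> vanishes_off K f ->
  vanishes_off K ('D_v f).
Proof.
move=> cK f0 z Kz.
rewrite (@near_derive _ _ (~` K) f (fun=> 0))//; last by rewrite openC.
exact: derive_cst.
Qed.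

Lemma compact_box K : compact K -> exists M : R, forall z, K z ->
  `|z| <= M /\ (forall i, `|z.1 0 i| <= M) /\ `|z.2| <= M.
Proof.
move=> /compact_bounded [M [_ KM]]; exists (M + 2) => z Kz.
have zM : `|z| <= M + 1 by apply: KM => //; rewrite ltrDl.
(* Membership in a ball unfolds coordinate by coordinate. The ball is open, so its radius must
   exceed the bound [M + 1] on the norm. *)
have : ball (0 : V) (M + 2) z.
  by rewrite -ball_normE/= sub0r normrN (le_lt_trans zM)// ltrD2l ltr1n.
move=> [[_ /= B1] B2]; split; first by rewrite (le_trans zM)// lerD2l ler1n.
split=> [i|].
  by have := B1 0 i; rewrite mxE /ball/= sub0r normrN => /ltW.
by have := B2; rewrite /ball/= sub0r normrN => /ltW.
Qed.

Lemma compact_bound K f : compact K -> continuous f -> vanishes_off K f ->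
  exists C, forall z, `|f z| <= C.
Proof.
move=> cK cf f0.
have : compact (f @` K) by apply: continuous_compact => //; exact: continuous_subspaceT.
move=> /compact_bounded [M [_ KM]]; exists (`|M| + 1) => z.
have [Kz|Kz] := pselect (K z); last by rewrite f0// normr0 addr_ge0.
by apply: KM; [rewrite (le_lt_trans (ler_norm M))// ltrDl|exists z].
Qed.

Lemma point_integrable K f : compact K -> continuous f -> vanishes_off K f ->
  (lebesgue_tuple R n \x leb)%E.-integrable setT (EFin \o (f \o point)).
Proof.
move=> cK cf f0.
have [C fC] := compact_bound cK cf f0.
have [M KM] := compact_box cK.
have mI : measurable (`[- M, M]%classic : set mR) by exact: measurable_itv.
have lI : (leb `[(- M)%R, M]%classic < +oo)%E.
  by rewrite lebesgue_measure_itv; case: ifPn => // _; exact: ltey.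
have := @bounded_support_integrable R _ _ (lebesgue_tuple R n \x leb)%E
  (@box R n M `*` `[- M, M]%classic) (f \o point) C.
apply.
- by apply: measurableX => //; exact: measurable_box.
- rewrite [X in (X < _)%E]product_measure1E//; last exact: measurable_box.
  rewrite lte_mul_pinfty//; rewrite ge0_fin_numE//; exact: box_lty.
- exact: point_measurable.
- by move=> p; exact: fC.
- move=> p pB; apply: f0 => /KM[_ [p1 p2]]; apply: pB; split.
    by move=> i; have := p1 i; rewrite mxE ler_norml.
  by rewrite /= in_itv/= -ler_norml.
Qed.

Lemma slice_boxed K f (t : R) : compact K -> continuous f -> vanishes_off K f ->
  boxed (fun s : n.-tuple mR => f (point (s, t))).
Proof.
move=> cK cf f0; split.
  have m : measurable_fun setT (fun s : n.-tuple mR => (s, t : mR)).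
    exact: measurable_fun_pair.
  exact: measurableT_comp (point_measurable cf) m.
have [C fC] := compact_bound cK cf f0.
have [M KM] := compact_box cK.
exists C, M; split=> [s|s sM]; first exact: fC.
apply: f0 => /KM[_ [p1 _]]; apply: sM => i.
by have := p1 i; rewrite mxE ler_norml.
Qed.

Lemma integral_derive_dir K f v z : compact K -> v != 0 ->
  (forall x, derivable f x v) -> continuous ('D_v f) ->
  vanishes_off K f -> vanishes_off K ('D_v f) ->
  (\int[leb]_a ('D_v f (a *: v + z))%:E = 0)%E.
Proof.
move=> cK v0 df cdf f0 df0.
have [M KM] := compact_box cK.
(* Beyond this threshold, the norm of [a *: v + z] is at least that of [a *: v] minus that of [z],
   hence larger than [M]. *)
have out a : (M + `|z|) / `|v| < `|a| -> ~ K (a *: v + z).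
  move=> aM /KM[+ _]; apply/negP; rewrite -ltNge.
  have : M + `|z| < `|a *: v|.
    by rewrite normrZ -ltr_pdivrMr// normr_gt0.
  rewrite -ltrBDr => /lt_le_trans; apply.
  by rewrite lerBlDr -{1}(addrK z (a *: v)) ler_normB.
apply: (@integral_derive_line (fun a => f (a *: v + z)) _ ((M + `|z|) / `|v|)).
- by move=> a; exact: is_derive_line.
- move=> a; apply: (@continuous_comp _ _ _ (fun a : R => a *: v + z) ('D_v f)).
    by apply: cvgD; [apply: cvgZr_tmp; exact: cvg_id|exact: cvg_cst].
  exact: cdf.
- by move=> a /out; exact: f0.
- by move=> a /out; exact: df0.
Qed.

Lemma integral_dt K f : compact K -> closed K ->
  (forall x, derivable f x (0, 1)) -> continuous (dt f) -> vanishes_off K f ->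
  integral_space (dt f) = 0%E.
Proof.
move=> cK clK df cdf f0.
have df0 : vanishes_off K (dt f) by exact: vanishes_derive.
rewrite /integral_space -integral12_prod_meas1; last first.
  exact: point_integrable cK cdf df0.
apply: integral0_eq => s _; rewrite /fubini_F.
have v0 : ((0, 1) : V) != 0 by apply/eqP => -[/eqP]; rewrite oner_eq0.
apply: etrans (integral_derive_dir (\row_i tnth s i, 0) cK v0 df cdf f0 df0).
apply: eq_integral => a _; congr (dt f _)%:E.
by congr pair; rewrite /= ?scaler0 ?add0r// addr0 [a *: _]mulr1.
Qed.

Lemma integral_dx K f j : compact K -> closed K ->
  (forall x, derivable f x (delta_mx 0 j, 0)) -> continuous (dx j f) ->
  vanishes_off K f -> integral_space (dx j f) = 0%E.
Proof.
move=> cK clK df cdf f0.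
have df0 : vanishes_off K (dx j f) by exact: vanishes_derive.
rewrite /integral_space -integral21_prod_meas1; last first.
  exact: point_integrable cK cdf df0.
apply: integral0_eq => t _; rewrite /fubini_G.
apply: (integral_tuple_line (j := j) (slice_boxed t cK cdf df0)) => s.
have v0 : ((delta_mx 0 j, 0) : V) != 0.
  by apply/eqP => -[/rowP/(_ j)]; rewrite !mxE !eqxx/= => /eqP; rewrite oner_eq0.
(* The base point has its [j]th coordinate set to 0, so that the parameter [a] of the line is that
   coordinate. *)
apply: etrans (integral_derive_dir (point (tuple_upd s j 0, t)) cK v0 df cdf f0 df0).
apply: eq_integral => a _; congr (dx j f _)%:E.
congr pair; rewrite /= ?scaler0 ?add0r//.
apply/rowP => k; rewrite !mxE !tnth_mktuple eqxx/=.
by case: eqVneq => _; rewrite ?mulr1 ?mulr0 ?add0r ?addr0.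
Qed.

Lemma x0_null : (0 < n)%N ->
  (lebesgue_tuple R n \x leb)%E
    [set p | forall i, (tnth p.1 i : R) = 0] = 0%E.
Proof.
move=> n0.
rewrite (_ : mkset _ = [set s : n.-tuple mR | forall i, (tnth s i : R) = 0]
   `*` [set: mR]); last first.
  by apply/seteqP; split=> p //= [].
have mZ := @measurable_tuple_zero R n.
by rewrite [LHS]product_measure1E// [X in (X * _)%E]tuple_zero_null// mul0e.
Qed.

End compact_support.
End compactly_supported.

(** * The Grushin frame away from the origin *)

Section derivations.
Context {R : realType} {V : normedModType R} (A : set V) (oA : open A).
Implicit Types (f g : V -> R) (X Y : (V -> R) -> V -> R).

(** Locality, linearity and the Leibniz rule suffice for all later computations. They pass to
    combinations with smooth coefficients, so [euler] and [tang j] obey the same rules as the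
    partial derivatives. *)
Record derivation X : Prop := Derivation {
  drvS : forall f, smooth_on A f -> smooth_on A (X f);
  drv_ext : forall f g z, (forall x, A x -> f x = g x) -> A z -> X f z = X g z;
  drvC : forall c z, A z -> X (fun=> c) z = 0;
  drvD : forall f g z, smooth_on A f -> smooth_on A g -> A z ->
    X (fun x => f x + g x) z = X f z + X g z;
  drvM : forall f g z, smooth_on A f -> smooth_on A g -> A z ->
    X (fun x => f x * g x) z = X f z * g z + f z * X g z }.

Lemma drvZ X c f z : derivation X -> smooth_on A f -> A z ->
  X (fun x => c * f x) z = c * X f z.
Proof.
move=> dX sf Az; rewrite (drvM dX (smooth_on_cst A c) sf Az) (drvC dX c Az).
by rewrite mul0r add0r.
Qed.

Lemma drvB X f g z : derivation X -> smooth_on A f -> smooth_on A g -> A z ->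
  X (fun x => f x - g x) z = X f z - X g z.
Proof.
move=> dX sf sg Az.
have E x : A x -> f x - g x = f x + -1 * g x by rewrite mulN1r.
rewrite (drv_ext dX E Az).
rewrite (drvD dX sf)//; last exact: smooth_onM oA (smooth_on_cst A _) sg.
by rewrite (drvZ _ dX)// mulN1r.
Qed.

Lemma drv_sum X n (F : 'I_n -> V -> R) z : derivation X ->
  (forall i, smooth_on A (F i)) -> A z ->
  X (fun x => \sum_i F i x) z = \sum_i X (F i) z.
Proof.
move=> dX; elim: n F => [|n IH] F sF Az.
  rewrite big_ord0; apply: etrans (drvC dX 0 Az).
  by apply: (drv_ext dX) => // x _; rewrite big_ord0.
rewrite big_ord_recl -IH// -(drvD dX)//; last exact: smooth_on_sum.
by apply: (drv_ext dX) => // x _; rewrite big_ord_recl.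
Qed.

Lemma derive_derivation v : derivation (fun f => 'D_v f).
Proof.
split.
- by move=> f; exact: smooth_on_derive.
- by move=> f g z fg Az; exact: near_derive fg Az.
- by move=> c z _; exact: derive_cst.
- move=> f g z sf sg Az; apply: deriveD; [exact: smooth_on_derivable sf Az|].
  exact: smooth_on_derivable sg Az.
- move=> f g z sf sg Az; apply: deriveM_fun; [exact: smooth_on_derivable sf Az|].
  exact: smooth_on_derivable sg Az.
Qed.

Lemma comb_derivation n (c : 'I_n -> V -> R) (X : 'I_n -> (V -> R) -> V -> R) :
  (forall i, smooth_on A (c i)) -> (forall i, derivation (X i)) ->
  derivation (fun f z => \sum_i c i z * X i f z).
Proof.
move=> sc dX; split.
- move=> f sf; apply: smooth_on_sum => // i; apply: smooth_onM => //.
  exact: drvS (dX i) _ sf.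
- by move=> f g z fg Az; apply: eq_bigr => i _; rewrite (drv_ext (dX i) fg Az).
- by move=> k z Az; rewrite big1// => i _; rewrite (drvC (dX i))// mulr0.
- move=> f g z sf sg Az; rewrite -big_split; apply: eq_bigr => i _.
  by rewrite (drvD (dX i))// mulrDr.
- move=> f g z sf sg Az; rewrite mulr_suml mulr_sumr -big_split/=.
  by apply: eq_bigr => i _; rewrite (drvM (dX i))//; ring.
Qed.

Lemma sub_derivation c X Y : smooth_on A c -> derivation X -> derivation Y ->
  derivation (fun f z => X f z - c z * Y f z).
Proof.
move=> sc dX dY; split.
- move=> f sf; apply: smooth_onB => //; first exact: drvS.
  by apply: smooth_onM => //; exact: drvS.
- by move=> f g z fg Az; rewrite (drv_ext dX fg)// (drv_ext dY fg).
- by move=> k z Az; rewrite (drvC dX)// (drvC dY)// mulr0 subr0.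
- by move=> f g z sf sg Az; rewrite (drvD dX)// (drvD dY)//; ring.
- by move=> f g z sf sg Az; rewrite (drvM dX)// (drvM dY)//; ring.
Qed.

(* [q = N ^ (-1/2)], differentiated through [q ^ 2 N = 1]. *)
Lemma drv_rsqrt X q N z : derivation X -> smooth_on A q -> smooth_on A N ->
  (forall x, A x -> q x ^+ 2 * N x = 1) -> A z ->
  X q z = - (2^-1) * q z ^+ 3 * X N z.
Proof.
move=> dX sq sN qN Az.
have : X (fun x => q x * q x * N x) z = 0.
  apply: etrans (drvC dX 1 Az).
  by apply: (drv_ext dX) => // x Ax; rewrite -expr2 qN.
rewrite (drvM dX)//; last exact: smooth_onM.
rewrite (drvM dX)// => E.
have qNz := qN z Az.
have : q z * (X q z * q z + q z * X q z) * N z + q z ^+ 3 * X N z = 0.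
  by rewrite -[RHS](mulr0 (q z)) -E; ring.
have -> : q z * (X q z * q z + q z * X q z) * N z =
    2 * X q z * (q z ^+ 2 * N z) by ring.
by rewrite qNz => E2; lra.
Qed.

End derivations.

(** * Coordinate fields, dilation field and tangential fields: homogeneity and commutators *)

Section grushin_frame.
Context {R : realType} {n : nat}.
Local Notation V := ('rV[R]_n * R)%type.
Implicit Types (f g : V -> R) (z : V) (j : 'I_n.+1) (B : set V).

Definition punctured : set V := [set z | z != 0].
Local Notation A := punctured.

Lemma open_punctured : open A.
Proof.
rewrite (_ : A = ~` [set 0]); last by apply/seteqP; split=> z /= /eqP.
rewrite openC.
exact: (accessible_closed_set1 (hausdorff_accessible (@norm_hausdorff R V))).
Qed.
Hint Resolve open_punctured : core.

(* In the notation of the header, [wt j], [coor j], [mult j] and [radc j] are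
   [d_j], [y_j], [m_j] and [c_j], while [rho4] is [rho ^ 4] and [irho2] is
   [rho ^ -2].  The derivative [frame j] is locked because unification otherwise
   unfolds it down to limits. *)
Definition dir j : V := if unlift ord_max j is Some i then (delta_mx 0 i, 0)
  else (0, 1).
Definition coor j z : R := if unlift ord_max j is Some i then z.1 0 i else z.2.
Definition wt j : R := if unlift ord_max j is Some i then 1 else 2.
Definition xsqr z : R := \sum_(i < n) z.1 0 i ^+ 2.
Definition mult j z : R := if unlift ord_max j is Some i then 1 else xsqr z.
Definition radg j z : R := if unlift ord_max j is Some i then xsqr z else 2.
Definition rho4 z : R := xsqr z ^+ 2 + 4 * z.2 ^+ 2.
Definition irho2 z : R := rho4 z `^ (- 2^-1).
Definition radc j z : R := radg j z * coor j z * irho2 z ^+ 2.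
Definition frame j f : V -> R := locked ('D_(dir j) f).
Definition euler f z : R := \sum_j wt j * coor j z * frame j f z.
Definition tang j f z : R := frame j f z - radc j z * euler f z.

Lemma frameE j f z : frame j f z = 'D_(dir j) f z.
Proof. by rewrite /frame -lock. Qed.

Lemma sum_unlift (F : option 'I_n -> R) :
  \sum_(j < n.+1) F (unlift ord_max j) = \sum_(i < n) F (Some i) + F None.
Proof.
rewrite big_ord_recr/= unlift_none; congr (_ + _); apply: eq_bigr => i _.
congr F; rewrite -[X in unlift _ X](_ : lift ord_max i = _) ?liftK//.
by apply/val_inj; rewrite /= /bump leqNgt ltn_ord.
Qed.

Lemma rho4_gt0 z : A z -> 0 < rho4 z.
Proof.
move=> Az; rewrite lt_neqAle; apply/andP; split; last first.
  by rewrite addr_ge0// ?sqr_ge0// mulr_ge0// sqr_ge0.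
apply: contraNneq Az => /esym/eqP.
rewrite paddr_eq0; [|exact: sqr_ge0|by apply: mulr_ge0 => //; exact: sqr_ge0].
rewrite sqrf_eq0 mulf_eq0 pnatr_eq0/= sqrf_eq0 psumr_eq0; last by move=> i _;
  exact: sqr_ge0.
case: z => x t /= /andP[/allP x0 /eqP ->]; apply/eqP; congr pair.
apply/rowP => i; rewrite mxE; apply/eqP.
by have := x0 i (mem_index_enum _); rewrite sqrf_eq0.
Qed.

Lemma irho2_rho4 z : A z -> irho2 z ^+ 2 * rho4 z = 1.
Proof.
move=> /rho4_gt0 N0; rewrite /irho2 -powR_mulrn ?powR_ge0// -powRrM.
by rewrite mulNr mulVf// powR_inv1 ?ltW// mulVf// gt_eqF.
Qed.

Lemma coor_is_linear j : linear (coor j).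
Proof.
by move=> a x y; rewrite /coor; case: unlift => [i|] //=; rewrite !mxE.
Qed.

HB.instance Definition _ j := GRing.isLinear.Build R V R _ (coor j) (coor_is_linear j).

Lemma coor_continuous j : continuous (coor j).
Proof.
move=> z; rewrite /coor; case: unlift => [i|]; last exact: cvg_snd.
apply: (@continuous_comp _ _ _ fst (fun x : 'rV[R]_n => x 0 i)).
  exact: cvg_fst.
exact: coord_continuous.
Qed.

Lemma coor_differentiable j z : differentiable (coor j) z.
Proof. by apply: linear_differentiable; exact: coor_continuous. Qed.

Lemma derive_coor j v z : 'D_v (coor j) z = coor j v.
Proof.
rewrite deriveE; last exact: coor_differentiable.
by rewrite diff_lin//; exact: coor_continuous.
Qed.

Lemma smooth_coor_on B j : smooth_on B (coor j).
Proof.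
case=> [|k]; (split; first by move=> z _; exact: coor_differentiable) => //= v.
rewrite (_ : 'D_v _ = fun=> coor j v); first exact: smooth_upto_cst.
by apply/funext => z; exact: derive_coor.
Qed.

Lemma smooth_coor j : smooth_on A (coor j).
Proof. exact: smooth_coor_on. Qed.

Lemma frame_coor i j z : frame i (coor j) z = (i == j)%:R.
Proof.
rewrite frameE derive_coor /coor /dir.
case: unliftP => [k ->|->]; case: unliftP => [l ->|->]/=.
- by rewrite mxE /= eq_sym (inj_eq (@lift_inj _ _)).
- by rewrite mxE (negPf (neq_lift _ _)).
- by rewrite eq_sym (negPf (neq_lift _ _)).
- by rewrite eqxx.
Qed.

Lemma dir_derivation_on B j : open B -> derivation B (frame j).
Proof.
move=> oB.
rewrite (_ : frame j = fun f => 'D_(dir j) f); first exact: derive_derivation.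
by apply/funext => f; apply/funext => z; rewrite frameE.
Qed.

Lemma smooth_dir_derivation j : derivation A (frame j).
Proof. exact: dir_derivation_on. Qed.

Lemma frame_comm i j f z : smooth_on A f -> A z ->
  frame i (frame j f) z = frame j (frame i f) z.
Proof.
have PE k g : frame k g = 'D_(dir k) g by apply/funext => x; rewrite frameE.
move=> sf Az; rewrite (PE i) (PE j f) (PE j) (PE i f).
exact: (@derive_comm R V A f (dir i) (dir j) z open_punctured sf Az).
Qed.

Lemma wt_coor_smooth j : smooth_on A (fun z => wt j * coor j z).
Proof.
apply: smooth_onM => //; first exact: smooth_on_cst; exact: smooth_coor.
Qed.

Lemma euler_derivation : derivation A euler.
Proof.
apply: (comb_derivation open_punctured wt_coor_smooth) => j.
exact: smooth_dir_derivation.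
Qed.

(** Summing over all [n + 1] coordinates, with weight 0 on [t], lets smoothness and derivatives
    follow from those of [coor j]. *)
Lemma xsqrE z : xsqr z = \sum_j (if unlift ord_max j is Some _ then 1 else 0)
  * coor j z ^+ 2.
Proof.
rewrite (sum_unlift (fun o => (if o is Some _ then 1 else 0) *
  (if o is Some i then z.1 0 i else z.2) ^+ 2))/= mul0r addr0.
by apply: eq_bigr => i _; rewrite mul1r.
Qed.

Lemma smooth_xsqr_on B : open B -> smooth_on B xsqr.
Proof.
move=> oB.
have E z : B z -> \sum_j (if unlift ord_max j is Some _ then 1 else 0) *
    coor j z ^+ 2 = xsqr z by rewrite xsqrE.
apply: (smooth_on_ext oB E).
apply: smooth_on_sum => // j; apply: smooth_onM => //; first exact: smooth_on_cst.
by apply: smooth_onX => //; exact: smooth_coor_on.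
Qed.

Lemma smooth_xsqr : smooth_on A xsqr.
Proof. exact: smooth_xsqr_on. Qed.

Lemma smooth_snd : smooth_on A snd.
Proof.
rewrite (_ : snd = coor ord_max); first exact: smooth_coor.
by apply/funext => z; rewrite /coor unlift_none.
Qed.

Lemma smooth_rho4 : smooth_on A rho4.
Proof.
apply: smooth_onD => //; first by apply: smooth_onX => //; exact: smooth_xsqr.
apply: smooth_onM => //; first exact: smooth_on_cst.
by apply: smooth_onX => //; exact: smooth_snd.
Qed.

Lemma smooth_irho2 : smooth_on A irho2.
Proof. by apply: smooth_on_powR => //; [exact: rho4_gt0|exact: smooth_rho4]. Qed.

Lemma smooth_mult j : smooth_on A (mult j).
Proof.
by rewrite /mult; case: unlift => [_|]; [exact: smooth_on_cst|exact: smooth_xsqr].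
Qed.

Lemma smooth_radg j : smooth_on A (radg j).
Proof.
by rewrite /radg; case: unlift => [_|]; [exact: smooth_xsqr|exact: smooth_on_cst].
Qed.

Lemma smooth_radc j : smooth_on A (radc j).
Proof.
apply: smooth_onM => //; last by apply: smooth_onX => //; exact: smooth_irho2.
by apply: smooth_onM => //; [exact: smooth_radg|exact: smooth_coor].
Qed.

Lemma tang_derivation j : derivation A (tang j).
Proof.
apply: (sub_derivation open_punctured (smooth_radc j) _ euler_derivation).
exact: smooth_dir_derivation.
Qed.

Lemma euler_coor j z : A z -> euler (coor j) z = wt j * coor j z.
Proof.
move=> Az; rewrite /euler (bigD1 j)//= frame_coor eqxx mulr1 big1 ?addr0// => i ij.
by rewrite frame_coor (negPf ij) mulr0.
Qed.

Lemma drv_sqr X f z : derivation A X -> smooth_on A f -> A z ->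
  X (fun x => f x ^+ 2) z = 2 * f z * X f z.
Proof.
move=> dX sf Az.
rewrite (drv_ext dX (g := fun x => f x * f x))//.
by rewrite (drvM dX)//; ring.
Qed.

Lemma frame_xsqr j z : A z ->
  frame j xsqr z = if unlift ord_max j is Some i then 2 * z.1 0 i else 0.
Proof.
move=> Az; have dP := smooth_dir_derivation j.
rewrite (drv_ext dP (fun x _ => xsqrE x) Az) (drv_sum open_punctured dP) => //;
  last first.
  move=> i; apply: smooth_onM => //; first exact: smooth_on_cst.
  by apply: smooth_onX => //; exact: smooth_coor.
rewrite (eq_bigr (fun k => (if unlift ord_max k is Some _ then 1 else 0) *
    (2 * coor k z * (j == k)%:R))).
  rewrite (bigD1 j)//= eqxx big1 ?addr0 ?mulr1; last first.
    by move=> i ij; rewrite eq_sym (negPf ij) !mulr0.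
  by rewrite /coor; case: unlift => [i|]; rewrite ?mul1r ?mul0r.
move=> k _; rewrite (drvZ _ dP)//; last first.
  by apply: smooth_onX => //; exact: smooth_coor.
by rewrite (drv_sqr dP)//; [rewrite frame_coor|exact: smooth_coor].
Qed.

Lemma frame_snd j z : A z -> frame j snd z = if unlift ord_max j is Some i then 0
  else 1.
Proof.
move=> Az; rewrite (_ : snd = coor ord_max).
  rewrite frame_coor; case: unliftP => [k ->|->]; last by rewrite eqxx.
  by rewrite eq_sym (negPf (neq_lift _ _)).
by apply/funext => x; rewrite /coor unlift_none.
Qed.

Lemma drv_rho4 X z : derivation A X -> A z ->
  X rho4 z = 2 * xsqr z * X xsqr z + 8 * z.2 * X snd z.
Proof.
move=> dX Az; rewrite /rho4 (drvD dX)//.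
- rewrite (drv_sqr dX smooth_xsqr Az) (drvZ _ dX)//.
    by rewrite (drv_sqr dX smooth_snd Az); ring.
  by apply: smooth_onX => //; exact: smooth_snd.
- by apply: smooth_onX => //; exact: smooth_xsqr.
- apply: smooth_onM => //; first exact: smooth_on_cst.
  by apply: smooth_onX => //; exact: smooth_snd.
Qed.

Lemma frame_rho4 j z : A z -> frame j rho4 z = 4 * radg j z * coor j z.
Proof.
move=> Az; rewrite (drv_rho4 (smooth_dir_derivation j) Az) frame_xsqr// frame_snd//.
by rewrite /radg /coor; case: unlift => [i|]; ring.
Qed.

Lemma euler_xsqr z : A z -> euler xsqr z = 2 * xsqr z.
Proof.
move=> Az; rewrite /euler.
rewrite (eq_bigr (fun j => 2 * ((if unlift ord_max j is Some _ then 1 else 0)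
  * coor j z ^+ 2))); first by rewrite -mulr_sumr -xsqrE.
move=> j _; rewrite frame_xsqr// /wt /coor.
by case: unlift => [i|]; ring.
Qed.

Lemma euler_snd z : A z -> euler snd z = 2 * z.2.
Proof.
move=> Az; rewrite (_ : snd = coor ord_max).
  by rewrite euler_coor// /wt /coor unlift_none.
by apply/funext => x; rewrite /coor unlift_none.
Qed.

Lemma euler_rho4 z : A z -> euler rho4 z = 4 * rho4 z.
Proof.
move=> Az; rewrite (drv_rho4 euler_derivation Az) euler_xsqr// euler_snd// /rho4; ring.
Qed.

Lemma euler_irho2 z : A z -> euler irho2 z = - 2 * irho2 z.
Proof.
move=> Az; rewrite (drv_rsqrt open_punctured euler_derivation smooth_irho2
  smooth_rho4 irho2_rho4 Az).
rewrite euler_rho4//.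
have -> : - 2^-1 * irho2 z ^+ 3 * (4 * rho4 z) = -2 * irho2 z * (irho2 z ^+ 2 * rho4
  z) by field.
by rewrite irho2_rho4// mulr1.
Qed.

(** This identifies [radc j] as the logarithmic derivative of [rho] along the [j]th coordinate. *)
Lemma frame_irho2 j z : A z -> frame j irho2 z = - 2 * radc j z * irho2 z.
Proof.
move=> Az.
rewrite (drv_rsqrt open_punctured (smooth_dir_derivation j)
  smooth_irho2 smooth_rho4 irho2_rho4 Az).
by rewrite frame_rho4// /radc; field.
Qed.

(** The coefficient [radc j] in [tang j] is chosen for this: tangential fields annihilate functions
    of [rho]. *)
Lemma tang_irho2 j z : A z -> tang j irho2 z = 0.
Proof. by move=> Az; rewrite /tang frame_irho2// euler_irho2//; ring. Qed.

(** Euler's relation for homogeneous functions: [4 - 2 * wt j] is 2 for the [x_j], where [radg j] is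
    [|x|^2], and 0 for [t], where it is constant. The degrees of [mult j] and [radc j] below are
    likewise written uniformly in [wt j]. *)
Lemma euler_radg j z : A z -> euler (radg j) z = (4 - 2 * wt j) * radg j z.
Proof.
move=> Az; rewrite /radg /wt; case: unlift => [i|].
  by rewrite euler_xsqr//; ring.
by rewrite (drvC euler_derivation _ Az); ring.
Qed.

Lemma euler_mult j z : A z -> euler (mult j) z = 2 * (wt j - 1) * mult j z.
Proof.
move=> Az; rewrite /mult /wt; case: unlift => [i|].
  by rewrite (drvC euler_derivation _ Az); ring.
by rewrite euler_xsqr//; ring.
Qed.

(** The weight of [t] depends on [x] only. Hence [m_j] passes through [P_j], and the Grushin
    operator has divergence form. *)
Lemma frame_mult j z : A z -> frame j (mult j) z = 0.
Proof.
move=> Az; rewrite /mult; case E : (unlift ord_max j) => [i|].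
  exact: (drvC (smooth_dir_derivation j) 1 Az).
by rewrite frame_xsqr// E.
Qed.

Lemma euler_radc j z : A z -> euler (radc j) z = - wt j * radc j z.
Proof.
move=> Az; have dE := euler_derivation.
have sg := smooth_radg j; have sc := smooth_coor j; have sq := smooth_irho2.
rewrite /radc (drvM dE (smooth_onM open_punctured sg sc)
  (smooth_onX _ open_punctured sq))//.
rewrite (drvM dE sg sc)// (drv_sqr dE sq)// euler_radg// euler_coor// euler_irho2//;
  ring.
Qed.

(** The weighted gradient of [rho] is parallel to the dilation field: the factor
    [xsqr z * irho2 z ^+ 2] is the same for every [j]. This is what makes the polar decomposition
    work. *)
Lemma mult_radc j z : mult j z * radc j z = xsqr z * irho2 z ^+ 2 * (wt j * coor j z).
Proof.
by rewrite /radc /mult /radg /wt; case: unlift => [i|]; ring.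
Qed.

(** This is [E rho = rho] divided by [rho]; in coordinates the sum is [irho2 z ^+ 2 * rho4 z]. *)
Lemma sum_wt_coor_radc z : A z -> \sum_j wt j * coor j z * radc j z = 1.
Proof.
move=> Az; rewrite -(irho2_rho4 Az).
rewrite (eq_bigr (fun j => irho2 z ^+ 2 * (wt j * radg j z * coor j z ^+ 2)));
  last first.
  by move=> j _; rewrite /radc; ring.
rewrite -mulr_sumr; congr (_ * _).
rewrite (sum_unlift (fun o => (if o is Some _ then 1 else 2) *
  (if o is Some _ then xsqr z else 2) *
  (if o is Some i then z.1 0 i else z.2) ^+ 2)) /= /rho4.
congr (_ + _); last by ring.
transitivity (\sum_(i < n) xsqr z * z.1 0 i ^+ 2).
  by apply: eq_bigr => i _; rewrite mul1r.
by rewrite -mulr_sumr [RHS]expr2.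
Qed.

(** The term [wt j * frame j f z] comes from differentiating the coefficient [wt j * coor j] of [E];
    the second derivatives commute. *)
Lemma frame_euler j f z : smooth_on A f -> A z ->
  frame j (euler f) z = euler (frame j f) z + wt j * frame j f z.
Proof.
move=> sf Az; have dP := smooth_dir_derivation.
have sP i : smooth_on A (frame i f) by exact: drvS.
rewrite {1}/euler (drv_sum open_punctured (dP j))//; last first.
  by move=> i; apply: smooth_onM => //; exact: wt_coor_smooth.
rewrite /euler (eq_bigr (fun i => wt i * coor i z * frame i (frame j f) z +
   wt i * (j == i)%:R * frame i f z)).
  rewrite big_split /=; congr (_ + _).
  rewrite (bigD1 j)//= eqxx big1 ?addr0 ?mulr1// => i ij.
  by rewrite eq_sym (negPf ij) mulr0 mul0r.
move=> i _; rewrite (drvM (dP j) (wt_coor_smooth i) (sP i) Az).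
by rewrite (drvZ _ (dP j) (smooth_coor i) Az) frame_coor addrC (frame_comm i j sf Az).
Qed.

(** The commutator is that of [frame j], because [radc j] has degree [- wt j]. *)
Lemma tang_euler j f z : smooth_on A f -> A z ->
  tang j (euler f) z = euler (tang j f) z + wt j * tang j f z.
Proof.
move=> sf Az; have dE := euler_derivation.
have sE : smooth_on A (euler f) by exact: drvS.
have sP : smooth_on A (frame j f) by exact: drvS (smooth_dir_derivation j) _ sf.
rewrite [in RHS]/tang (drvB open_punctured dE sP)//; last first.
  by apply: smooth_onM => //; exact: smooth_radc.
rewrite (drvM dE (smooth_radc j) sE Az) euler_radc// {1}/tang frame_euler//; ring.
Qed.

Lemma sum_coor_tang f z : A z -> \sum_j wt j * coor j z * tang j f z = 0.
Proof.
move=> Az.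
rewrite (eq_bigr (fun j => wt j * coor j z * frame j f z -
  (wt j * coor j z * radc j z) * euler f z)); last by move=> j _; rewrite /tang; ring.
by rewrite sumrB -mulr_suml sum_wt_coor_radc// mul1r subrr.
Qed.

End grushin_frame.

(** * The pointwise identity *)

Section rellich.
Context {R : realType} {n : nat}.
Local Notation V := ('rV[R]_n * R)%type.
Implicit Types (z : V) (j : 'I_n.+1).
Local Notation A := (@punctured R n).
Local Notation Q := (hdim R n).
Variables (u : V -> R) (su : smooth_on A u).

Let oA := @open_punctured R n.
Hint Resolve oA : core.

Definition radial0 z : R := euler (euler u) z + (Q - 2) * euler u z.
Definition radial z : R := irho2 z * radial0 z.
Definition spherical z : R := \sum_j mult j z * frame j (tang j u) z.
(** The density integrated by parts along [E]. Its first part cancels the term [v_j E E v_j] of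
    [2 m_j v_j P_j F]; the coefficient of [v_j^2] is then forced by the cross term [v_j E v_j] of
    the square in [sterm]. *)
Definition hterm j z : R := mult j z * irho2 z *
  (- 2 * (tang j u z * euler (tang j u) z) + (2 - Q - 2 * wt j) * tang j u z ^+ 2).
(** The first summand moves [P_j] from [v_j] to [F]; the second is the dilation field times the
    total density, whose divergence is given by [divergence_euler]. *)
Definition flux j z : R := 2 * (radial z * (mult j z * tang j u z)) +
  wt j * coor j z * \sum_i hterm i z.
(** In the square, [(Q - 2) / 2] comes from the power of [rho] in the last term of the theorem, and
    [wt j - 1] is the degree of the factor [m_j^(1/2)] of [L_j u]. *)
Definition sterm j z : R := irho2 z * mult j z *
  (Q * (Q - 4) / 2 * tang j u z ^+ 2 +
   2 * (euler (tang j u) z + ((Q - 2) / 2 + (wt j - 1)) * tang j u z) ^+ 2).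

Let dE := @euler_derivation R n.
Let dP := @smooth_dir_derivation R n.
Let dL := @tang_derivation R n.
Let sE : smooth_on A (euler u). Proof. exact: drvS. Qed.
Let sEE : smooth_on A (euler (euler u)). Proof. exact: drvS. Qed.
Let sv j : smooth_on A (tang j u). Proof. exact: drvS. Qed.
Let sEv j : smooth_on A (euler (tang j u)). Proof. exact: drvS. Qed.

Lemma smooth_radial0 : smooth_on A radial0.
Proof.
by apply: smooth_onD => //; apply: smooth_onM => //; exact: smooth_on_cst.
Qed.

Lemma smooth_radial : smooth_on A radial.
Proof. by apply: smooth_onM => //; [exact: smooth_irho2|exact: smooth_radial0]. Qed.

Lemma smooth_spherical : smooth_on A spherical.
Proof.
apply: smooth_on_sum => // j; apply: smooth_onM => //; first exact: smooth_mult.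
exact: drvS.
Qed.

Lemma smooth_hterm j : smooth_on A (hterm j).
Proof.
apply: smooth_onM => //.
  by apply: smooth_onM => //; [exact: smooth_mult|exact: smooth_irho2].
apply: smooth_onD => //; apply: smooth_onM => //; try exact: smooth_on_cst.
- exact: smooth_onM.
- exact: smooth_onX.
Qed.

Lemma smooth_flux j : smooth_on A (flux j).
Proof.
apply: smooth_onD => //; apply: smooth_onM => //; try exact: smooth_on_cst.
- apply: smooth_onM => //; first exact: smooth_radial.
  by apply: smooth_onM => //; exact: smooth_mult.
- exact: wt_coor_smooth.
- by apply: smooth_on_sum => // i; exact: smooth_hterm.
Qed.

Lemma sum_wt : \sum_(j < n.+1) wt j = Q.
Proof.
rewrite (sum_unlift (fun o : option 'I_n => if o is Some _ then 1 else 2))/=.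
by rewrite sumr_const card_ord /hdim natrD.
Qed.

Lemma divergence_euler f z : smooth_on A f -> A z ->
  \sum_j frame j (fun x => wt j * coor j x * f x) z = euler f z + Q * f z.
Proof.
move=> sf Az; rewrite -sum_wt mulr_suml /euler -big_split/=.
apply: eq_bigr => j _; rewrite (drvM (dP j))//; last exact: wt_coor_smooth.
rewrite (drvZ _ (dP j) (smooth_coor j) Az) frame_coor eqxx mulr1; ring.
Qed.

(** Write [P_j u = v_j + c_j E u]. By [mult_radc], the radial part [m_j c_j E u] is [w] times the
    dilation field, so its divergence is [E w + Q w]. The factor of [E u] in [w] has degree -2,
    which is the origin of [Q - 2] in [radial0]. *)
Lemma laplacian_decomposition z : A z ->
  \sum_j mult j z * frame j (frame j u) z = spherical z + xsqr z * irho2 z * radial z.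
Proof.
move=> Az.
pose w x : R := xsqr x * irho2 x ^+ 2 * euler u x.
have srq : smooth_on A (fun x : V => xsqr x * irho2 x ^+ 2).
  apply: smooth_onM => //; first exact: smooth_xsqr.
  by apply: smooth_onX => //; exact: smooth_irho2.
have sw : smooth_on A w by exact: smooth_onM.
have scE j : smooth_on A (fun x => radc j x * euler u x).
  by apply: smooth_onM => //; exact: smooth_radc.
have term j : mult j z * frame j (frame j u) z =
    mult j z * frame j (tang j u) z + frame j (fun x => wt j * coor j x * w x) z.
  have -> : frame j (frame j u) z = frame j (fun x => tang j u x + radc j x * euler u
    x) z.
    by apply: (drv_ext (dP j)) => // x _; rewrite /tang subrK.
  rewrite (drvD (dP j))// mulrDr; congr (_ + _).
  have -> : frame j (fun x => wt j * coor j x * w x) z =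
      frame j (fun x => mult j x * (radc j x * euler u x)) z.
    apply: (drv_ext (dP j)) => // x _; rewrite mulrA mult_radc /w; ring.
  by rewrite (drvM (dP j) (smooth_mult j))// frame_mult// mul0r add0r.
rewrite (eq_bigr _ (fun j _ => term j)) big_split/= divergence_euler//.
congr (_ + _); rewrite /w (drvM dE srq)//.
rewrite (drvM dE smooth_xsqr (smooth_onX _ oA smooth_irho2))//.
rewrite (drv_sqr dE smooth_irho2)// euler_xsqr// euler_irho2// /radial /radial0; ring.
Qed.

(** The left side is the sum of the [L_j^2 u]; the term with [wt j - 1] arises from differentiating
    [|x|]. By [mult_radc], the difference of the two sides is a multiple of a combination of
    [sum_j d_j y_j v_j = 0] and of its derivative along [E]. *)
Lemma spherical_laplacian z : A z ->
  \sum_j mult j z * (tang j (tang j u) z - (wt j - 1) * radc j z * tang j u z) =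
  spherical z.
Proof.
move=> Az; apply/eqP; rewrite -subr_eq0 -sumrB; apply/eqP.
have E0 : euler (fun x => \sum_j wt j * coor j x * tang j u x) z = 0.
  apply: etrans (drvC dE 0 Az).
  by apply: (drv_ext dE) => // x Ax; exact: sum_coor_tang.
have {}E0 : \sum_j (wt j * (wt j * coor j z) * tang j u z +
     wt j * coor j z * euler (tang j u) z) = 0.
  apply: etrans E0; rewrite (drv_sum oA dE)//; last first.
    by move=> j; apply: smooth_onM => //; exact: wt_coor_smooth.
  apply: eq_bigr => j _; rewrite (drvM dE (wt_coor_smooth j))//.
  by rewrite (drvZ _ dE (smooth_coor j))// euler_coor//; ring.
have L0 := sum_coor_tang u Az.
transitivity (- (xsqr z * irho2 z ^+ 2) * (\sum_j (wt j * (wt j * coor j z)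
  * tang j u z +
     wt j * coor j z * euler (tang j u) z) - \sum_j wt j * coor j z * tang j u z)).
  rewrite -sumrB mulr_sumr; apply: eq_bigr => j _.
  have := mult_radc j z; rewrite {1}/tang => mc.
  transitivity (- (mult j z * radc j z) *
    (euler (tang j u) z + (wt j - 1) * tang j u z)); first by rewrite {1}/tang; ring.
  rewrite mc; ring.
by rewrite E0 L0 subrr mulr0.
Qed.

(** Since [tang j] turns [E] into [E + wt j], the polynomial [E^2 + (Q - 2) E] becomes
    [(E + wt j)^2 + (Q - 2) (E + wt j)], while [irho2] acts as a constant. *)
Lemma tang_radial j z : A z -> tang j radial z = irho2 z *
  (euler (euler (tang j u)) z + (2 * wt j + Q - 2) * euler (tang j u) z +
   (wt j ^+ 2 + (Q - 2) * wt j) * tang j u z).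
Proof.
move=> Az; rewrite /radial (drvM (dL j) smooth_irho2 smooth_radial0)// tang_irho2//.
rewrite mul0r add0r; congr (_ * _).
rewrite /radial0 (drvD (dL j) sEE)//; last first.
  by apply: smooth_onM => //; exact: smooth_on_cst.
rewrite (drvZ _ (dL j) sE)// !tang_euler//.
have -> : euler (tang j (euler u)) z =
    euler (fun x => euler (tang j u) x + wt j * tang j u x) z.
  by apply: (drv_ext dE) => // x Ax; exact: tang_euler.
have sw : smooth_on A (fun x => wt j * tang j u x).
  by apply: smooth_onM => //; exact: smooth_on_cst.
rewrite (drvD dE (sEv j) sw)// (drvZ _ dE (sv j))//; ring.
Qed.

Lemma euler_hterm j z : A z -> euler (hterm j) z =
  (2 * (wt j - 1) - 2) * hterm j z + mult j z * irho2 z *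
   (- 2 * (euler (tang j u) z ^+ 2 + tang j u z * euler (euler (tang j u)) z)
    + (2 - Q - 2 * wt j) * (2 * tang j u z * euler (tang j u) z)).
Proof.
move=> Az; rewrite /hterm.
have smq : smooth_on A (fun x => mult j x * irho2 x).
  by apply: smooth_onM => //; [exact: smooth_mult|exact: smooth_irho2].
have svE : smooth_on A (fun x => tang j u x * euler (tang j u) x) by exact: smooth_onM.
have sv2 : smooth_on A (fun x => tang j u x ^+ 2) by exact: smooth_onX.
have s1 : smooth_on A (fun x => - 2 * (tang j u x * euler (tang j u) x)).
  by apply: smooth_onM => //; exact: smooth_on_cst.
have s2 : smooth_on A (fun x => (2 - Q - 2 * wt j) * tang j u x ^+ 2).
  by apply: smooth_onM => //; exact: smooth_on_cst.
rewrite (drvM dE smq (smooth_onD oA s1 s2))// (drvD dE s1 s2)//.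
rewrite (drvZ _ dE svE)// (drvZ _ dE sv2)// (drv_sqr dE (sv j))//.
rewrite (drvM dE (sv j) (sEv j))// (drvM dE (smooth_mult j) smooth_irho2)//.
rewrite euler_mult// euler_irho2//; ring.
Qed.

Lemma radial_spherical z : A z ->
  2 * radial z * spherical z = \sum_j sterm j z + \sum_j frame j (flux j) z.
Proof.
move=> Az.
have smv j : smooth_on A (fun x => mult j x * tang j u x).
  by apply: smooth_onM => //; exact: smooth_mult.
have sF := smooth_radial.
have sFmv j : smooth_on A (fun x => radial x * (mult j x * tang j u x)).
  exact: smooth_onM.
have sh : smooth_on A (fun x => \sum_i hterm i x).
  by apply: smooth_on_sum => // i; exact: smooth_hterm.
have -> : \sum_j frame j (flux j) z =
    2 * radial z * spherical z +
    \sum_j 2 * (mult j z * tang j u z * tang j radial z) +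
    \sum_j (euler (hterm j) z + Q * hterm j z).
  transitivity (\sum_j (2 * radial z * (mult j z * frame j (tang j u) z) +
      2 * (mult j z * tang j u z * tang j radial z)
      + 2 * euler radial z * (xsqr z * irho2 z ^+ 2) * (wt j * coor j z * tang j u z)) +
      \sum_j frame j (fun x => wt j * coor j x * \sum_i hterm i x) z).
    rewrite -big_split/=; apply: eq_bigr => j _.
    have s1 : smooth_on A (fun x => 2 * (radial x * (mult j x * tang j u x))).
      by apply: smooth_onM => //; exact: smooth_on_cst.
    have s2 : smooth_on A (fun x => wt j * coor j x * \sum_i hterm i x).
      by apply: smooth_onM => //; exact: wt_coor_smooth.
    rewrite (drvD (dP j) s1 s2 Az); congr (_ + _); rewrite (drvZ _ (dP j) (sFmv j))//
      (drvM (dP j) sF (smv j))//.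
    rewrite (drvM (dP j) (smooth_mult j) (sv j))// frame_mult// mul0r add0r.
    (* The radial part of the gradient of [F] produces a multiple of [sum_j d_j y_j v_j], which
       vanishes. *)
    have -> : frame j radial z = tang j radial z + radc j z * euler radial z.
      by rewrite {1}/tang subrK.
    have mc := mult_radc j z.
    transitivity (2 * radial z * (mult j z * frame j (tang j u) z) +
      2 * (mult j z * tang j u z * tang j radial z)
      + 2 * euler radial z * (mult j z * radc j z) * tang j u z); first by ring.
    by rewrite mc; ring.
  rewrite divergence_euler// !big_split/= -!mulr_sumr sum_coor_tang// mulr0 addr0.
  rewrite (drv_sum oA dE)//; exact: smooth_hterm.
(* The cancellation holds for each [j] separately, as an identity between polynomials in [v_j],
   [E v_j] and [E E v_j]. *)
have Z : \sum_j sterm j z + (\sum_j 2 * (mult j z * tang j u z * tang j radial z) +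
    \sum_j (euler (hterm j) z + Q * hterm j z)) = 0.
  rewrite -!big_split/= big1// => j _.
  by rewrite tang_radial// euler_hterm// /sterm /hterm; field.
by lra.
Qed.

End rellich.

(** * The operators of the statement in terms of the frame *)

Section bridge.
Context {R : realType} {n : nat}.
Local Notation V := ('rV[R]_n * R)%type.
Implicit Types (f : V -> R) (z : V) (j : 'I_n.+1) (B : set V).
Local Notation A := (@punctured R n).
Local Notation Q := (hdim R n).
Let oA := @open_punctured R n.
Hint Resolve oA : core.

Lemma frame_dx (i : 'I_n) f z : frame (lift ord_max i) f z = dx i f z.
Proof. by rewrite frameE /dir liftK. Qed.

Lemma frame_dt f z : frame ord_max f z = dt f z.
Proof. by rewrite frameE /dir unlift_none. Qed.

Lemma big_unlift (F : 'I_n.+1 -> R) :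
  \sum_j F j = \sum_(i < n) F (lift ord_max i) + F ord_max.
Proof.
rewrite big_ord_recr/=; congr (_ + _); apply: eq_bigr => i _; congr F.
by apply/val_inj; rewrite /= /bump leqNgt ltn_ord.
Qed.

Lemma wt_lift (i : 'I_n) : wt (lift ord_max i) = 1 :> R.
Proof. by rewrite /wt liftK. Qed.
Lemma wt_max : wt (@ord_max n) = 2 :> R.
Proof. by rewrite /wt unlift_none. Qed.
Lemma coor_lift (i : 'I_n) z : coor (lift ord_max i) z = z.1 0 i.
Proof. by rewrite /coor liftK. Qed.
Lemma coor_max z : coor ord_max z = z.2.
Proof. by rewrite /coor unlift_none. Qed.
Lemma mult_lift (i : 'I_n) z : mult (lift ord_max i) z = 1.
Proof. by rewrite /mult liftK. Qed.
Lemma mult_max z : mult ord_max z = xsqr z.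
Proof. by rewrite /mult unlift_none. Qed.

Lemma xsqr_ge0 z : 0 <= xsqr z.
Proof. by apply: sumr_ge0 => i _; exact: sqr_ge0. Qed.

Lemma enorm_sqr z : enorm z.1 ^+ 2 = xsqr z.
Proof. by rewrite /enorm sqr_sqrtr ?xsqr_ge0. Qed.

Lemma rhoE z : rho z = rho4 z `^ 4^-1.
Proof. by rewrite /rho /rho4 -enorm_sqr -exprM. Qed.

Lemma rho_gt0 z : A z -> 0 < rho z.
Proof. by move=> Az; rewrite rhoE powR_gt0// rho4_gt0. Qed.

Lemma rho_irho2 z : A z -> rho z ^+ 2 * irho2 z = 1.
Proof.
move=> /rho4_gt0 N0; rewrite rhoE -powR_mulrn ?powR_ge0// -powRrM /irho2 powRN.
have -> : 4^-1 * 2%:R = 2^-1 :> R by field.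
by rewrite mulfV// gt_eqF// powR_gt0.
Qed.

Lemma rhoV z : A z -> (rho z)^-1 = rho z * irho2 z.
Proof.
move=> Az; have r0 := rho_gt0 Az.
by apply: (mulfI (lt0r_neq0 r0)); rewrite mulfV ?gt_eqF// mulrA -expr2 rho_irho2.
Qed.

Lemma smooth_rho : smooth_on A rho.
Proof.
have E z : A z -> rho4 z `^ 4^-1 = rho z by rewrite rhoE.
by apply: (smooth_on_ext oA E); apply: smooth_on_powR => //;
  [exact: rho4_gt0|exact: smooth_rho4].
Qed.

(** Differentiating [rho ^ 2 * irho2 = 1] avoids the fourth root in [rho]. *)
Lemma drv_rho X c z : derivation A X -> A z -> X irho2 z = - 2 * c * irho2 z ->
  X rho z = c * rho z.
Proof.
move=> dX Az Xq.
have sr2 : smooth_on A (fun x : V => rho x ^+ 2).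
  by apply: smooth_onX => //; exact: smooth_rho.
have : X (fun x => rho x ^+ 2 * irho2 x) z = 0.
  apply: etrans (drvC dX 1 Az).
  by apply: (drv_ext dX) => // x Ax; rewrite rho_irho2.
rewrite (drvM dX sr2 smooth_irho2)// (drv_sqr dX smooth_rho)// Xq => E.
have r0 := rho_gt0 Az.
have rq : rho z * irho2 z != 0.
  by rewrite -rhoV// invr_neq0// gt_eqF.
apply: (mulfI rq); lra.
Qed.

Lemma euler_rho z : A z -> euler rho z = rho z.
Proof.
move=> Az; rewrite (drv_rho (c := 1) euler_derivation Az) ?mul1r//.
by rewrite mulr1 euler_irho2.
Qed.

Lemma frame_rho j z : A z -> frame j rho z = radc j z * rho z.
Proof.
by move=> Az; apply: (drv_rho (smooth_dir_derivation j) Az); exact: frame_irho2.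
Qed.

Lemma drhoE f z : drho f z = (rho z)^-1 * euler f z.
Proof.
rewrite /drho /euler big_unlift; congr (_ * (_ + _)).
  by apply: eq_bigr => i _; rewrite wt_lift coor_lift frame_dx mul1r.
by rewrite wt_max coor_max frame_dt.
Qed.

(* The square root of [mult j]: the spherical field of index [j] is [smult j] times the
   smooth field [tang j]. *)
Definition smult j z : R := if unlift ord_max j is Some _ then 1 else enorm z.1.

Lemma smult_sqr j z : smult j z ^+ 2 = mult j z.
Proof.
by rewrite /smult /mult; case: unlift => [i|]; rewrite ?expr1n// enorm_sqr.
Qed.

Lemma LsphE j f z : A z -> Lsph j f z = smult j z * tang j f z.
Proof.
move=> Az; have r0 := lt0r_neq0 (rho_gt0 Az).
rewrite /Lsph /smult /tang; case: unliftP => [i ->|->].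
  rewrite -!frame_dx frame_rho// drhoE mul1r; congr (_ - _).
  by rewrite mulrA mulfK.
rewrite -!frame_dt frame_rho// drhoE mulrBr; congr (_ - _).
by rewrite -!mulrA mulVKf.
Qed.

Lemma LG_E u z : LG u z = \sum_j mult j z * frame j (frame j u) z.
Proof.
have frame_fun_dx (i : 'I_n) : dx i u = frame (lift ord_max i) u.
  by apply/funext => x; rewrite frame_dx.
have frame_fun_dt : dt u = frame ord_max u by apply/funext => x; rewrite frame_dt.
rewrite /LG big_unlift mult_max enorm_sqr frame_fun_dt frame_dt; congr (_ + _).
by apply: eq_bigr => i _; rewrite mult_lift mul1r frame_fun_dx frame_dx.
Qed.

Lemma gradG_rho z : A z -> enorm1 (gradG rho z) ^+ 2 = xsqr z * irho2 z.
Proof.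
move=> Az; rewrite /enorm1 sqr_sqrtr; last by rewrite addr_ge0 ?sqr_ge0.
rewrite enorm_sqr /xsqr /gradG /= exprMn enorm_sqr.
transitivity (\sum_j rho z ^+ 2 * (mult j z * radc j z * radc j z)).
  rewrite big_unlift mult_max -frame_dt frame_rho//; congr (_ + _); last by ring.
  apply: eq_bigr => i _; rewrite mxE -frame_dx frame_rho// mult_lift; ring.
rewrite -mulr_sumr.
rewrite (eq_bigr (fun j => xsqr z * irho2 z ^+ 2 * (wt j * coor j z * radc j z)));
  last first.
  by move=> j _; rewrite mult_radc; ring.
rewrite -mulr_sumr sum_wt_coor_radc// mulr1.
transitivity (xsqr z * irho2 z * (rho z ^+ 2 * irho2 z)); first by ring.
by rewrite rho_irho2// mulr1.
Qed.

Lemma psiE z : A z -> psi z = xsqr z * irho2 z.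
Proof.
move=> Az; rewrite /psi enorm_sqr; congr (_ * _).
have r0 := lt0r_neq0 (rho_gt0 Az).
have r20 : rho z ^+ 2 != 0 by rewrite expf_neq0.
by apply: (mulfI r20); rewrite mulfV// rho_irho2.
Qed.

(** The radial derivative is [rho * irho2] times [E], and that factor has degree -1. This lowers
    [Q - 1] to the [Q - 2] of [radial0]. *)
Lemma LrhoG_E u z : smooth_on A u -> A z ->
  LrhoG u z = xsqr z * irho2 z * radial u z.
Proof.
move=> su Az; have dE := @euler_derivation R n.
have sE : smooth_on A (euler u) by exact: drvS.
have srq : smooth_on A (fun x : V => rho x * irho2 x).
  by apply: smooth_onM => //; [exact: smooth_rho|exact: smooth_irho2].
rewrite /LrhoG psiE//; congr (_ * _).
have -> : drho (drho u) z = (rho z)^-1 * euler (fun x => rho x * irho2 x * euler u x) z.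
  rewrite drhoE; congr (_ * _); apply: (drv_ext dE) => // x Ax.
  by rewrite drhoE rhoV.
rewrite (drvM dE srq sE)// (drvM dE smooth_rho smooth_irho2)// euler_rho//
  euler_irho2//.
rewrite drhoE rhoV// /radial /radial0.
transitivity (rho z ^+ 2 * irho2 z * (irho2 z * (euler (euler u) z + (Q - 2)
  * euler u z))).
  ring.
by rewrite rho_irho2// mul1r.
Qed.

End bridge.

(** * The spherical fields across the set [x = 0], and propagation of the support *)

Section singular.
Context {R : realType} {n : nat}.
Local Notation V := ('rV[R]_n * R)%type.
Implicit Types (f : V -> R) (z : V) (j : 'I_n.+1) (B K : set V).
Local Notation A := (@punctured R n).
Local Notation Q := (hdim R n).
Let oA := @open_punctured R n.
Hint Resolve oA : core.

(** The open set on which [smult j] is nonzero and smooth; only the [t] field has to avoid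
    [x = 0]. *)
Definition sdom j : set V :=
  if unlift ord_max j is Some _ then A else [set z | xsqr z != 0].

Lemma xsqr_continuous : continuous (@xsqr R n).
Proof.
by move=> z; apply: (@smooth_on_continuous _ _ setT) => //; apply: smooth_xsqr_on;
  exact: openT.
Qed.

Lemma open_sdom j : open (sdom j).
Proof.
rewrite /sdom; case: unlift => [_|] //.
rewrite (_ : mkset _ = xsqr @^-1` [set y : R | y != 0]) //.
move/continuousP: xsqr_continuous; apply; exact: open_neq.
Qed.
Arguments open_sdom : clear implicits.
Hint Resolve open_sdom : core.

Lemma xsqr_punctured z : xsqr z != 0 -> A z.
Proof.
apply: contra_neq => ->; rewrite /xsqr big1// => i _; by rewrite /= mxE expr0n.
Qed.

Lemma sub_sdom j : sdom j `<=` A.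
Proof. by rewrite /sdom; case: unlift => [_|] // z; exact: xsqr_punctured. Qed.

Lemma smult_eq0 j z : A z -> ~ sdom j z ->
  [/\ j = ord_max, xsqr z = 0 & smult j z = 0].
Proof.
rewrite /sdom /smult; case: unliftP => [i ->|->] // _ /negP; rewrite negbK => /eqP r0.
by split=> //; apply/eqP; rewrite -sqrf_eq0 enorm_sqr r0.
Qed.

Lemma smult_neq0 j z : sdom j z -> smult j z != 0.
Proof.
by rewrite -sqrf_eq0 smult_sqr /sdom /mult; case: unlift => [_|].
Qed.

Lemma smooth_smult j : smooth_on (sdom j) (smult j).
Proof.
case E : (unlift ord_max j) => [i|].
  rewrite (_ : smult j = fun=> 1); first exact: smooth_on_cst.
  by apply/funext => z; rewrite /smult E.
have e z : sdom j z -> xsqr z `^ 2^-1 = smult j z.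
  by rewrite /smult E powR12_sqrt ?xsqr_ge0.
refine (smooth_on_ext (open_sdom j) e _); apply: smooth_on_powR => //.
  by move=> z; rewrite /sdom E /= => r0; rewrite lt_neqAle eq_sym r0 xsqr_ge0.
exact: smooth_xsqr_on.
Qed.

Lemma drv_smult X j z : derivation (sdom j) X -> sdom j z ->
  2 * smult j z * X (smult j) z = X (mult j) z.
Proof.
move=> dX jz.
have -> : X (mult j) z = X (fun x => smult j x * smult j x) z.
  by apply: (drv_ext dX) => // x _; rewrite -smult_sqr expr2.
by rewrite (drvM dX (smooth_smult j) (smooth_smult j))//; ring.
Qed.

Lemma euler_derivation_on B : open B -> derivation B (@euler R n).
Proof.
move=> oB; apply: (comb_derivation oB) => j; last exact: dir_derivation_on.
apply: smooth_onM => //; first exact: smooth_on_cst; exact: smooth_coor_on.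
Qed.

Lemma tang_derivation_on B j : open B -> B `<=` A -> derivation B (@tang R n j).
Proof.
move=> oB BA; apply: (sub_derivation oB).
- exact: smooth_on_sub BA (smooth_radc j).
- exact: dir_derivation_on.
- exact: euler_derivation_on.
Qed.

Lemma euler_smult j z : sdom j z -> euler (smult j) z = (wt j - 1) * smult j z.
Proof.
move=> jz; have dE := euler_derivation_on (open_sdom j).
have s0 := smult_neq0 jz; apply: (mulfI s0).
have := drv_smult dE jz; rewrite euler_mult; last exact: sub_sdom jz.
rewrite -smult_sqr => E; lra.
Qed.

Lemma tang_smult j z : sdom j z -> tang j (smult j) z = - ((wt j - 1)
  * radc j z * smult j z).
Proof.
move=> jz; have dP := dir_derivation_on j (open_sdom j).
have P0 : frame j (smult j) z = 0.
  have s0 := smult_neq0 jz; apply: (mulfI s0); rewrite mulr0.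
  have := drv_smult dP jz; rewrite frame_mult; last exact: sub_sdom jz.
  by move=> E; lra.
by rewrite /tang P0 euler_smult//; ring.
Qed.

Section smooth_function.
Variables (u : V -> R) (su : smooth_on A u).

Let svj j : smooth_on (sdom j) (tang j u).
Proof. by apply: smooth_on_sub (@sub_sdom j) _; exact: drvS (tang_derivation j)
  _ su. Qed.

(** Where [x = 0], the function [L_(n+1) u] need not be differentiable, but the outer field carries
    the factor [|x| = 0], so both sides vanish whatever value the derivative takes. *)
Lemma Lsph_Lsph j z : A z -> Lsph j (Lsph j u) z =
  mult j z * (tang j (tang j u) z - (wt j - 1) * radc j z * tang j u z).
Proof.
move=> Az; rewrite LsphE// -smult_sqr expr2.
have [jz|jz] := pselect (sdom j z); last first.
  by have [_ _ ->] := smult_eq0 Az jz; rewrite !mul0r.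
have dL := tang_derivation_on j (open_sdom j) (@sub_sdom j).
have -> : tang j (Lsph j u) z = tang j (fun x => smult j x * tang j u x) z.
  by apply: (drv_ext dL) => // x /sub_sdom; exact: LsphE.
by rewrite (drvM dL (smooth_smult j) (svj j))// tang_smult//; ring.
Qed.

Lemma Lsph_sqr j z : A z ->
  `|Lsph j u z| ^+ 2 / rho z ^+ 2 = irho2 z * mult j z * tang j u z ^+ 2.
Proof.
move=> Az; rewrite real_normK ?num_real// LsphE// exprMn smult_sqr.
have -> : (rho z ^+ 2)^-1 = irho2 z.
  have r20 : rho z ^+ 2 != 0 by rewrite expf_neq0// gt_eqF// rho_gt0.
  by apply: (mulfI r20); rewrite mulfV// rho_irho2.
ring.
Qed.

Lemma euler_rho_powR (a : R) z : A z -> euler (fun x => rho x `^ a) z = a * rho z `^ a.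
Proof.
move=> Az; have r0 := rho_gt0 Az.
transitivity (a * rho z `^ (a - 1) * euler rho z).
  rewrite /euler mulr_sumr; apply: eq_bigr => j _; rewrite !frameE.
  rewrite derive_powR//; last exact: smooth_on_diff smooth_rho Az.
  ring.
have -> : rho z `^ (a - 1) = rho z `^ a / rho z.
  rewrite powRB; first by rewrite powRr1// ltW.
  by apply/implyP => _; rewrite gt_eqF.
by rewrite euler_rho// -!mulrA mulVf ?mulr1// gt_eqF.
Qed.

(** Here no outer factor [|x|] helps. In [E], the possibly undefined derivatives in [x_i] have
    coefficient [x_i = 0], and along [t] the function is identically 0. *)
Lemma euler_powR_Lsph0 j (a : R) z : j = ord_max -> xsqr z = 0 ->
  euler (fun z' => rho z' `^ a * Lsph j u z') z = 0.
Proof.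
move=> jE r0; set g := (fun z' => _).
have e0 : enorm z.1 = 0 by apply/eqP; rewrite -sqrf_eq0 enorm_sqr r0.
have g0 y : y.1 = z.1 -> g y = 0.
  by move=> yz; rewrite /g /Lsph jE unlift_none yz e0 !mul0r subrr mulr0.
have z0 i : z.1 0 i = 0.
  apply/eqP; rewrite -sqrf_eq0; move/eqP : r0; rewrite psumr_eq0.
    by move=> /allP/(_ i (mem_index_enum _)).
  by move=> k _; exact: sqr_ge0.
have Pg : frame ord_max g z = 0.
  rewrite frameE; apply: derive_eq0 => h.
  have e1 : (h *: dir ord_max + z).1 = z.1.
    by rewrite /dir unlift_none /= scaler0 add0r.
  by rewrite (g0 _ e1) (g0 _ erefl).
rewrite /euler big_unlift Pg mulr0 addr0 big1// => i _.
by rewrite coor_lift z0 mulr0 mul0r.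
Qed.

Lemma drho_powR_Lsph j (a : R) z : A z ->
  drho (fun z' => rho z' `^ a * Lsph j u z') z =
  (rho z)^-1 * (rho z `^ a * (smult j z *
    (euler (tang j u) z + (a + (wt j - 1)) * tang j u z))).
Proof.
move=> Az; rewrite drhoE; congr (_ * _).
have [jz|jz] := pselect (sdom j z); last first.
  have [jE r0 s0] := smult_eq0 Az jz.
  apply: etrans (euler_powR_Lsph0 a jE r0) _.
  by rewrite s0 mul0r mulr0.
have dE := euler_derivation_on (open_sdom j).
have sm := smooth_smult j; have sv := svj j.
have sr : smooth_on (sdom j) (fun x => rho x `^ a).
  apply: smooth_on_powR => //.
    by move=> x /sub_sdom; exact: rho_gt0.
  exact: smooth_on_sub (@sub_sdom j) smooth_rho.
have -> : euler (fun x => rho x `^ a * Lsph j u x) z =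
    euler (fun x => rho x `^ a * (smult j x * tang j u x)) z.
  by apply: (drv_ext dE) => // x /sub_sdom Ax; rewrite LsphE.
rewrite (drvM dE sr (smooth_onM (open_sdom j) sm sv))// (drvM dE sm sv)//.
by rewrite euler_rho_powR// euler_smult//; ring.
Qed.

Lemma powR_half_sqr (x a : R) : (x `^ (a / 2)) ^+ 2 = x `^ a.
Proof.
by rewrite -powR_mulrn ?powR_ge0// -powRrM; congr (_ `^ _); field.
Qed.

Lemma drho_powR_Lsph_sqr j z : A z ->
  rho z `^ (2 - Q) *
    `|drho (fun z' => rho z' `^ ((Q - 2) / 2) * Lsph j u z') z| ^+ 2 =
  irho2 z * mult j z *
    (euler (tang j u) z + ((Q - 2) / 2 + (wt j - 1)) * tang j u z) ^+ 2.
Proof.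
move=> Az; have r0 := rho_gt0 Az.
rewrite drho_powR_Lsph// real_normK ?num_real// !exprMn smult_sqr.
rewrite powR_half_sqr.
have -> : (rho z)^-1 ^+ 2 = irho2 z.
  rewrite rhoV// exprMn [X in _ * X]expr2 mulrA rho_irho2// mul1r//.
have E : rho z `^ (2 - Q) * rho z `^ (Q - 2) = 1.
  rewrite -powRD; last by apply/implyP => _; rewrite gt_eqF.
  by rewrite addrA subrK subrr powRr0.
set S := (_ + _) ^+ 2.
transitivity (rho z `^ (2 - Q) * rho z `^ (Q - 2) * (irho2 z * mult j z * S)).
  ring.
by rewrite E mul1r.
Qed.

End smooth_function.

Section vanishing.
Variables (K : set V) (clK : closed K).

Lemma vanishes_frame j f : vanishes_off K f -> vanishes_off K (frame j f).
Proof. by move=> f0 z Kz; rewrite frameE; exact: (@vanishes_derive R n K f (dir j)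
  clK f0 z Kz). Qed.

Lemma vanishes_euler f : vanishes_off K f -> vanishes_off K (euler f).
Proof.
by move=> f0 z Kz; rewrite /euler big1// => j _; rewrite vanishes_frame// mulr0.
Qed.

Lemma vanishes_tang j f : vanishes_off K f -> vanishes_off K (tang j f).
Proof.
by move=> f0 z Kz; rewrite /tang vanishes_frame// vanishes_euler// mulr0 subrr.
Qed.

Lemma vanishes_drho f : vanishes_off K f -> vanishes_off K (drho f).
Proof. by move=> f0 z Kz; rewrite drhoE vanishes_euler// mulr0. Qed.

Lemma vanishes_Lsph j f : vanishes_off K f -> vanishes_off K (Lsph j f).
Proof.
move=> f0 z Kz; rewrite /Lsph vanishes_drho//; case: unlift => [i|].
  by rewrite -frame_dx vanishes_frame// mulr0 subrr.
by rewrite -frame_dt vanishes_frame// !mulr0 subrr.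
Qed.

Lemma vanishes_LrhoG f : vanishes_off K f -> vanishes_off K (LrhoG f).
Proof.
move=> f0 z Kz; rewrite /LrhoG (vanishes_drho (vanishes_drho f0))//.
by rewrite vanishes_drho// mulr0 addr0 mulr0.
Qed.

Variables (u : V -> R) (u0 : vanishes_off K u).

Lemma vanishes_radial : vanishes_off K (radial u).
Proof.
move=> z Kz; rewrite /radial /radial0 (vanishes_euler (vanishes_euler u0))//.
by rewrite vanishes_euler// mulr0 addr0 mulr0.
Qed.

Lemma vanishes_spherical : vanishes_off K (spherical u).
Proof.
move=> z Kz; rewrite /spherical big1// => j _.
by rewrite (vanishes_frame _ (vanishes_tang j u0))// mulr0.
Qed.

Lemma vanishes_hterm j : vanishes_off K (hterm u j).
Proof.
by move=> z Kz; rewrite /hterm vanishes_tang// expr0n/= mul0r !mulr0 addr0 mulr0.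
Qed.

Lemma vanishes_flux j : vanishes_off K (flux u j).
Proof.
move=> z Kz; rewrite /flux vanishes_radial// mul0r mulr0 add0r big1 ?mulr0//.
by move=> i _; exact: vanishes_hterm.
Qed.

Hypothesis K0 : ~ K 0.

(** The origin has a neighbourhood outside the closed set [K], so smoothness off the origin extends
    across it. *)
Lemma vanishes_differentiable f z : smooth_on A f -> vanishes_off K f ->
  differentiable f z.
Proof.
move=> sf f0; have [Az|/negP] := pselect (A z); first exact: smooth_on_diff sf Az.
rewrite negbK => /eqP ->.
apply: (@near_differentiable _ _ (~` K) (fun=> 0)) => //.
- by rewrite openC.
- by move=> x Kx; rewrite f0.
Qed.

Lemma vanishes_continuous f : smooth_on A f -> vanishes_off K f -> continuous f.
Proof.
by move=> sf f0 z; exact: differentiable_continuous (vanishes_differentiable z sf f0).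
Qed.

End vanishing.
End singular.

(** * Integration of the pointwise identity *)

Section space_integral.
Context {R : realType} {n : nat}.
Local Notation V := ('rV[R]_n * R)%type.
Local Notation mR := (measurableTypeR R).
Local Notation leb := (@lebesgue_measure R).
Implicit Types (f g : V -> R).

Definition space_measurable f :=
  measurable_fun setT (fun p : n.-tuple mR * mR => f (point p)).

Lemma space_measurableD f g : space_measurable f -> space_measurable g ->
  space_measurable (fun z => f z + g z).
Proof. exact: measurable_funD. Qed.

Lemma space_measurableM f g : space_measurable f -> space_measurable g ->
  space_measurable (fun z => f z * g z).
Proof. exact: measurable_funM. Qed.

Lemma space_measurable_cst (c : R) : space_measurable (fun=> c).
Proof. exact: measurable_cst. Qed.

Lemma space_measurable_continuous f : continuous f -> space_measurable f.
Proof. exact: point_measurable. Qed.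

Lemma space_measurable_sum m (F : 'I_m -> V -> R) :
  (forall i, space_measurable (F i)) -> space_measurable (fun z => \sum_i F i z).
Proof. by move=> mF; apply: measurable_sum => i; exact: mF. Qed.

Lemma space_measurable_inv f : (forall z, 0 <= f z) -> space_measurable f ->
  space_measurable (fun z => (f z)^-1).
Proof.
move=> f0 mf; rewrite (_ : (fun z => _) = (fun z => f z `^ (-1))).
  exact: (measurableT_comp (@measurable_powR R (-1)) mf).
by apply/funext => z; rewrite powR_inv1.
Qed.

Let mu := (lebesgue_tuple R n \x leb)%E.

Lemma integral_spaceD f g : space_measurable f -> space_measurable g ->
  (forall z, 0 <= f z) -> (forall z, 0 <= g z) ->
  integral_space (fun z => f z + g z) = (integral_space f + integral_space g)%E.
Proof.
move=> mf mg f0 g0; rewrite /integral_space.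
under eq_integral do rewrite EFinD.
rewrite ge0_integralD//.
- by move=> p _; rewrite lee_fin.
- exact/measurable_EFinP.
- by move=> p _; rewrite lee_fin.
- exact/measurable_EFinP.
Qed.

Lemma integral_spaceZ (c : R) f : 0 <= c -> space_measurable f ->
  (forall z, 0 <= f z) ->
  integral_space (fun z => c * f z) = (c%:E * integral_space f)%E.
Proof.
move=> c0 mf f0; rewrite /integral_space.
under eq_integral do rewrite EFinM.
rewrite ge0_integralZl_EFin//.
- by move=> p _; rewrite lee_fin.
- exact/measurable_EFinP.
Qed.

Lemma integral_space_sum m (F : 'I_m -> V -> R) :
  (forall i, space_measurable (F i)) -> (forall i z, 0 <= F i z) ->
  integral_space (fun z => \sum_i F i z) = (\sum_i integral_space (F i))%E.
Proof.
move=> mF F0; rewrite /integral_space.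
under eq_integral do rewrite -sumEFin.
rewrite ge0_integral_sum//.
- by move=> i; apply/measurable_EFinP; exact: mF.
- by move=> i p _; rewrite lee_fin.
Qed.

Lemma integral_space_ae f g : (0 < n)%N -> space_measurable f ->
  space_measurable g -> (forall z, xsqr z != 0 -> f z = g z) ->
  integral_space f = integral_space g.
Proof.
move=> n0 mf mg fg; apply: ae_eq_integral => //.
- exact/measurable_EFinP.
- exact/measurable_EFinP.
exists [set p : n.-tuple mR * mR | forall i, (tnth p.1 i : R) = 0]; split.
- rewrite -big_setI_ord; apply: bigsetI_measurable => i _.
  rewrite -[X in measurable X]setTI.
  have m : measurable_fun setT (fun p : n.-tuple mR * mR => tnth p.1 i).
    by apply: (measurableT_comp (measurable_tnth i)) => //; exact: measurable_fst.
  exact: (m measurableT [set (0 : R)] (measurable_set1 _)).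
- exact: x0_null.
- move=> p /= /not_implyP[_ fgp] i.
  have r0 : xsqr (point p) = 0.
    by apply: contrapT => /eqP r0; apply: fgp; congr EFin; exact: fg.
  have /eqP := r0; rewrite psumr_eq0; last by move=> k _; exact: sqr_ge0.
  move=> /allP/(_ i (mem_index_enum _)); rewrite sqrf_eq0 mxE => /eqP.
  exact.
Qed.

(** The integrals of [h] and [f] may be infinite, so no subtraction is possible. Instead
    [h + g^- = f + g^+] is integrated between nonnegative functions, and the equal finite integrals
    of [g^-] and [g^+] are cancelled. *)
Lemma integral_space_perturb h f g : (0 < n)%N ->
  space_measurable h -> (forall z, 0 <= h z) ->
  space_measurable f -> (forall z, 0 <= f z) ->
  mu.-integrable setT (fun p => (g (point p))%:E) -> integral_space g = 0%E ->
  (forall z, xsqr z != 0 -> h z = f z + g z) ->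
  integral_space h = integral_space f.
Proof.
move=> n0 mh h0 mf f0 ig g0 hfg.
have mg : space_measurable g by apply/measurable_EFinP; exact: measurable_int ig.
pose gp z := Num.max (g z) 0; pose gn z := Num.max (- g z) 0.
have gp0 z : 0 <= gp z by rewrite /gp le_max lexx orbT.
have gn0 z : 0 <= gn z by rewrite /gn le_max lexx orbT.
have gE z : g z = gp z - gn z.
  rewrite /gp /gn; case: (boolP (0 <= g z)) => [g_ge0|]; last rewrite -ltNge => g_lt0.
    by rewrite max_l// max_r ?subr0// oppr_le0.
  by rewrite max_r ?ltW// max_l ?sub0r ?opprK// oppr_ge0 ltW.
have mgp : space_measurable gp by apply: measurable_maxr => //; exact: measurable_cst.
have mgn : space_measurable gn.
  apply: measurable_maxr; last exact: measurable_cst.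
  exact: (measurableT_comp (@oppr_measurable R setT) mg).
have pE : integral_space gp = (\int[mu]_p (fun p => (g (point p))%:E)^\+ p)%E.
  by apply: eq_integral => p _; rewrite funeposE -EFin_max.
have nE : integral_space gn = (\int[mu]_p (fun p => (g (point p))%:E)^\- p)%E.
  by apply: eq_integral => p _; rewrite funenegE -EFinN -EFin_max.
have fp : integral_space gp \is a fin_num.
  by rewrite pE; exact: integrable_pos_fin_num.
have fn : integral_space gn \is a fin_num.
  by rewrite nE; exact: integrable_neg_fin_num.
have pn : integral_space gp = integral_space gn.
  move: g0; rewrite /integral_space integralE -pE -nE => /eqP.
  by rewrite sube_eq ?add0e// ?fin_num_adde_defl// => /eqP.
have : (integral_space h + integral_space gn =
        integral_space f + integral_space gp)%E.
  rewrite -!integral_spaceD//; apply: integral_space_ae => //.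
  - exact: space_measurableD.
  - exact: space_measurableD.
  - by move=> z z0; rewrite hfg// gE; lra.
by rewrite pn => E; rewrite -[LHS](addeK _ fn) E addeK.
Qed.

End space_integral.

(** * The integrands of the theorem for a fixed test function *)

Section rellich_integrals.
Context {R : realType} {n : nat} (hn : (2 <= n)%N).
Local Notation V := ('rV[R]_n * R)%type.
Local Notation A := (@punctured R n).
Local Notation Q := (hdim R n).
Variables (u : V -> R) (hu : test_function u).
Let K := tsupport u.
Let oA := @open_punctured R n.
Hint Resolve oA : core.

Let cK : compact K. Proof. by have [] := hu. Qed.
Let clK : closed K. Proof. exact: closed_closure. Qed.
Let K0 : ~ K 0. Proof. by have [] := hu. Qed.
Let KA z : K z -> A z. Proof. by move=> Kz; apply/negP => /eqP z0; apply: K0;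
  rewrite -z0. Qed.

Let su : smooth_on A u.
Proof. by apply/smooth_onP => vs z _; have [+ _ _] := hu; apply. Qed.

Let u0 : vanishes_off K u.
Proof.
move=> z Kz; apply: contrapT => /eqP uz; apply: Kz; exact: subset_closure.
Qed.

Let lap z : R := \sum_j mult j z * frame j (frame j u) z.

Let smooth_lap : smooth_on A lap.
Proof.
apply: smooth_on_sum => // j; apply: smooth_onM => //; first exact: smooth_mult.
by apply: drvS (smooth_dir_derivation j) _ _; exact: drvS (smooth_dir_derivation j)
  _ su.
Qed.

Let vanishes_lap : vanishes_off K lap.
Proof.
move=> z Kz; rewrite /lap big1// => j _.
by rewrite (vanishes_frame clK j (vanishes_frame clK j u0))// mulr0.
Qed.

Let smooth_tang j : smooth_on A (tang j u).
Proof. exact: drvS (tang_derivation j) _ su. Qed.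

(** This is [f ^ 2 / psi], with [rho ^ 2] written [rho4 * irho2]. The singular factor [(xsqr z)^-1]
    stands apart, and the rest is continuous when [f] is smooth off the origin and vanishes off
    [K]. *)
Definition weighted (f : V -> R) z : R := (xsqr z)^-1 * (f z ^+ 2 * (rho4 z * irho2 z)).

Lemma weightedE f g z : vanishes_off K f -> (K z -> g z = f z) ->
  (~ K z -> g z = 0) ->
  `|g z| ^+ 2 / enorm1 (gradG rho z) ^+ 2 = weighted f z.
Proof.
move=> f0 gf g0; rewrite real_normK ?num_real// /weighted.
have [Kz|Kz] := pselect (K z); last by rewrite g0// f0// expr0n/= !mul0r mulr0.
have Az := KA Kz.
rewrite gf// gradG_rho// invfM.
have -> : (irho2 z)^-1 = rho4 z * irho2 z.
  have q0 : irho2 z != 0.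
    by apply: contraTneq (oner_neq0 R) => q0; rewrite -(irho2_rho4 Az)
      q0 expr0n/= mul0r eqxx.
  apply: (mulfI q0); rewrite mulfV//.
  by apply: etrans (esym (irho2_rho4 Az)) _; ring.
ring.
Qed.

Lemma weighted_measurable f : smooth_on A f -> vanishes_off K f ->
  space_measurable (weighted f).
Proof.
move=> sf f0; apply: space_measurableM.
  apply: space_measurable_inv; first exact: xsqr_ge0.
  by apply: space_measurable_continuous; exact: xsqr_continuous.
apply: space_measurable_continuous; apply: (vanishes_continuous clK K0).
  apply: smooth_onM => //; first exact: smooth_onX.
  by apply: smooth_onM => //; [exact: smooth_rho4|exact: smooth_irho2].
by move=> z Kz; rewrite f0// expr0n/= mul0r.
Qed.

Lemma rho4_ge0 (z : V) : 0 <= rho4 z.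
Proof. by rewrite addr_ge0 ?sqr_ge0// mulr_ge0// sqr_ge0. Qed.

Lemma weighted_ge0 f z : 0 <= weighted f z.
Proof.
rewrite mulr_ge0 ?invr_ge0 ?xsqr_ge0// mulr_ge0 ?sqr_ge0//.
by rewrite mulr_ge0 ?rho4_ge0 ?powR_ge0.
Qed.

Definition radial_part z : R := xsqr z * irho2 z * radial u z ^+ 2.
Definition sph_part j z : R := irho2 z * mult j z * tang j u z ^+ 2.
Definition mixed_part j z : R := irho2 z * mult j z *
  (euler (tang j u) z + ((Q - 2) / 2 + (wt j - 1)) * tang j u z) ^+ 2.
Definition div_part z : R := \sum_j frame j (flux u j) z.

Lemma mult_ge0 j (z : V) : 0 <= mult j z.
Proof. by rewrite /mult; case: unlift => [_|]; rewrite ?xsqr_ge0. Qed.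

Lemma smooth_vanishing_measurable f : smooth_on A f -> vanishes_off K f ->
  space_measurable f.
Proof.
by move=> sf f0; apply: space_measurable_continuous;
  exact: (vanishes_continuous clK K0).
Qed.

Lemma radial_part_measurable : space_measurable radial_part.
Proof.
apply: smooth_vanishing_measurable.
  apply: smooth_onM => //; last by apply: smooth_onX => //; exact: smooth_radial.
  by apply: smooth_onM => //; [exact: smooth_xsqr|exact: smooth_irho2].
by move=> z Kz; rewrite /radial_part (vanishes_radial clK u0)// expr0n/= mulr0.
Qed.

Let smooth_qm j : smooth_on A (fun z => irho2 z * mult j z).
Proof. by apply: smooth_onM => //; [exact: smooth_irho2|exact: smooth_mult]. Qed.

Lemma sph_part_measurable j : space_measurable (sph_part j).
Proof.
apply: smooth_vanishing_measurable.
  by apply: smooth_onM => //; exact: smooth_onX.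
by move=> z Kz; rewrite /sph_part (vanishes_tang clK _ u0)// expr0n/= mulr0.
Qed.

Lemma mixed_part_measurable j : space_measurable (mixed_part j).
Proof.
apply: smooth_vanishing_measurable.
  apply: smooth_onM => //; apply: smooth_onX => //; apply: smooth_onD => //.
    exact: drvS (@euler_derivation R n) _ (smooth_tang j).
  by apply: smooth_onM => //; exact: smooth_on_cst.
move=> z Kz; rewrite /mixed_part (vanishes_euler clK (vanishes_tang clK j u0))//.
by rewrite (vanishes_tang clK _ u0)// mulr0 addr0 expr0n/= mulr0.
Qed.

Let smooth_frame_flux j : smooth_on A (frame j (flux u j)).
Proof. exact: drvS (smooth_dir_derivation j) _ (smooth_flux su j). Qed.

Let vanishes_frame_flux j : vanishes_off K (frame j (flux u j)).
Proof.
move=> z Kz; exact: (vanishes_frame clK j (vanishes_flux clK u0 j) Kz).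
Qed.

Lemma integral_frame_flux j : integral_space (frame j (flux u j)) = 0%E.
Proof.
have sfl := smooth_flux su j; have f0 := vanishes_flux clK u0 j.
have dfl x v : derivable (flux u j) x v.
  by apply: diff_derivable; exact: (vanishes_differentiable clK K0 x sfl f0).
have cfl : continuous (frame j (flux u j)).
  exact: (vanishes_continuous clK K0 (smooth_frame_flux j) (vanishes_frame_flux j)).
case: (unliftP ord_max j) cfl => [i ji|ji] cfl.
  have E : frame j (flux u j) = dx i (flux u j).
    by apply/funext => z; rewrite {1}ji frame_dx.
  by rewrite E; apply: (integral_dx cK clK _ _ f0) => //; rewrite -E.
have E : frame j (flux u j) = dt (flux u j).
  by apply/funext => z; rewrite {1}ji frame_dt.
by rewrite E; apply: (integral_dt cK clK _ _ f0) => //; rewrite -E.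
Qed.

Let frame_flux_integrable j :
  (lebesgue_tuple R n \x @lebesgue_measure R)%E.-integrable setT
     (fun p => (frame j (flux u j) (point p))%:E).
Proof.
apply: (point_integrable cK _ (vanishes_frame_flux j)).
exact: (vanishes_continuous clK K0 (smooth_frame_flux j) (vanishes_frame_flux j)).
Qed.

Lemma div_part_integrable :
  (lebesgue_tuple R n \x @lebesgue_measure R)%E.-integrable setT
     (fun p => (div_part (point p))%:E).
Proof.
rewrite (_ : (fun p => _) = (fun p => \sum_j (frame j (flux u j) (point p))%:E)%E).
  by apply: integrable_sum.
by apply/funext => p; rewrite sumEFin.
Qed.

Lemma integral_div_part : integral_space div_part = 0%E.
Proof.
rewrite /integral_space; under eq_integral do rewrite /div_part -sumEFin.
rewrite integral_sum//; first by rewrite big1// => j _; exact: integral_frame_flux.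
Qed.

(** With [2 <= n], every term on the right is nonnegative, so the integral of their sum splits even
    when one of them is infinite. *)
Lemma hdim_coef_ge0 : 0 <= Q * (Q - 4) / 2.
Proof.
have Q4 : 4 <= Q by rewrite /hdim ler_nat addn2.
rewrite mulr_ge0 ?invr_ge0// mulr_ge0//; lra.
Qed.

Definition rhs_part z : R := (radial_part z + weighted (spherical u) z) +
  (Q * (Q - 4) / 2 * \sum_j sph_part j z + 2 * \sum_j mixed_part j z).

Lemma pointwise_identity z : xsqr z != 0 ->
  weighted lap z = rhs_part z + div_part z.
Proof.
move=> r0; have Az := xsqr_punctured r0.
have S : \sum_j sterm u j z =
    Q * (Q - 4) / 2 * \sum_j sph_part j z + 2 * \sum_j mixed_part j z.
  rewrite !mulr_sumr -big_split/=; apply: eq_bigr => j _.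
  rewrite /sterm /sph_part /mixed_part; ring.
have E := radial_spherical su Az; rewrite S in E.
have qN := irho2_rho4 Az; have L := laplacian_decomposition su Az.
rewrite /weighted /lap L /rhs_part /div_part.
transitivity (radial_part z + weighted (spherical u) z +
    2 * radial u z * spherical u z); last by rewrite E; ring.
rewrite /weighted /radial_part.
set r := xsqr z in r0 *; set s := spherical u z; set f := radial u z.
(* The square of [s + r * irho2 z * f] is expanded so that all terms but [s ^+ 2] carry the factor
   [irho2 z ^+ 2 * rho4 z = 1]. *)
transitivity (r^-1 * (s ^+ 2 * (rho4 z * irho2 z)) +
  (2 * f * s + r * irho2 z * f ^+ 2) * (irho2 z ^+ 2 * rho4 z)).
  by field.
by rewrite qN mulr1; ring.
Qed.

Let sS : smooth_on A (spherical u). Proof. exact: smooth_spherical. Qed.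
Let vS : vanishes_off K (spherical u).
Proof. exact: (vanishes_spherical clK u0). Qed.

Lemma sph_part_ge0 j z : 0 <= sph_part j z.
Proof.
exact: mulr_ge0 (mulr_ge0 (powR_ge0 _ _) (mult_ge0 _ _)) (sqr_ge0 _).
Qed.

Lemma mixed_part_ge0 j z : 0 <= mixed_part j z.
Proof.
exact: mulr_ge0 (mulr_ge0 (powR_ge0 _ _) (mult_ge0 _ _)) (sqr_ge0 _).
Qed.

Lemma radial_part_ge0 z : 0 <= radial_part z.
Proof.
exact: mulr_ge0 (mulr_ge0 (xsqr_ge0 _) (powR_ge0 _ _)) (sqr_ge0 _).
Qed.

Lemma integral_identity : integral_space (weighted lap) =
  (integral_space radial_part + integral_space (weighted (spherical u)) +
   (Q * (Q - 4) / 2)%:E * \sum_j integral_space (sph_part j) +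
   2%:E * \sum_j integral_space (mixed_part j))%E.
Proof.
have c0 := hdim_coef_ge0.
have m1 := radial_part_measurable.
have m2 := weighted_measurable sS vS.
have m3 := space_measurable_sum sph_part_measurable.
have m4 := space_measurable_sum mixed_part_measurable.
have s0 z : 0 <= \sum_j sph_part j z by apply: sumr_ge0 => j _; exact: sph_part_ge0.
have x0 z : 0 <= \sum_j mixed_part j z by apply: sumr_ge0 => j _; exact: mixed_part_ge0.
have m3' : space_measurable (fun z => Q * (Q - 4) / 2 * \sum_j sph_part j z).
  by apply: space_measurableM => //; exact: space_measurable_cst.
have m4' : space_measurable (fun z => 2 * \sum_j mixed_part j z).
  by apply: space_measurableM => //; exact: space_measurable_cst.
have w0 z : 0 <= radial_part z + weighted (spherical u) z.
  by rewrite addr_ge0 ?radial_part_ge0 ?weighted_ge0.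
have c0z z : 0 <= Q * (Q - 4) / 2 * \sum_j sph_part j z by rewrite mulr_ge0.
have x0z z : 0 <= 2 * \sum_j mixed_part j z by rewrite mulr_ge0.
have mr : space_measurable rhs_part.
  by apply: space_measurableD; apply: space_measurableD.
have r0 z : 0 <= rhs_part z by rewrite addr_ge0// addr_ge0.
have n0 : (0 < n)%N by exact: leq_trans hn.
rewrite (@integral_space_perturb R n _ rhs_part div_part n0).
- rewrite integral_spaceD//; [|exact: space_measurableD|exact: space_measurableD|
    by move=> z; rewrite addr_ge0].
  rewrite integral_spaceD//; [|exact: radial_part_ge0|exact: weighted_ge0].
  rewrite integral_spaceD// !integral_spaceZ// !integral_space_sum ?addeA//.
  + exact: mixed_part_measurable.
  + by move=> j z; exact: mixed_part_ge0.
  + exact: sph_part_measurable.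
  + by move=> j z; exact: sph_part_ge0.
- exact: weighted_measurable smooth_lap vanishes_lap.
- exact: weighted_ge0.
- exact: mr.
- exact: r0.
- exact: div_part_integrable.
- exact: integral_div_part.
- exact: pointwise_identity.
Qed.

Lemma LG_integrand z :
  `|LG u z| ^+ 2 / enorm1 (gradG rho z) ^+ 2 = weighted lap z.
Proof.
apply: (weightedE vanishes_lap) => Kz; rewrite LG_E//; exact: vanishes_lap Kz.
Qed.

Lemma LrhoG_integrand z :
  `|LrhoG u z| ^+ 2 / enorm1 (gradG rho z) ^+ 2 = radial_part z.
Proof.
rewrite real_normK ?num_real//.
have [Kz|Kz] := pselect (K z); last first.
  rewrite (vanishes_LrhoG clK u0)// expr0n/= mul0r /radial_part.
  by rewrite (vanishes_radial clK u0)// expr0n/= mulr0.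
have Az := KA Kz.
rewrite gradG_rho// LrhoG_E// /radial_part.
(* Where [psi] vanishes, the quotient is 0 by the convention on inverses, and so is
   [radial_part]. *)
have [->|rq0] := eqVneq (xsqr z * irho2 z) 0; first by rewrite !mul0r expr0n/= mul0r.
by move: (xsqr z * irho2 z) rq0 => c c_neq0; field.
Qed.

Lemma spherical_integrand z :
  `|\sum_(j < n.+1) Lsph j (Lsph j u) z| ^+ 2 / enorm1 (gradG rho z) ^+ 2 =
  weighted (spherical u) z.
Proof.
apply: (@weightedE _ (fun x => \sum_(j < n.+1) Lsph j (Lsph j u) x) z vS) => Kz.
  rewrite -spherical_laplacian//; last exact: KA.
  by apply: eq_bigr => j _; apply: Lsph_Lsph => //; exact: KA.
by rewrite big1// => j _; rewrite (vanishes_Lsph clK j (vanishes_Lsph clK j u0)).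
Qed.

Lemma Lsph_integrand j z : `|Lsph j u z| ^+ 2 / rho z ^+ 2 = sph_part j z.
Proof.
have [Kz|Kz] := pselect (K z).
  by apply: Lsph_sqr => //; exact: KA.
rewrite (vanishes_Lsph clK j u0)// normr0 expr0n/= mul0r /sph_part.
by rewrite (vanishes_tang clK j u0)// expr0n/= mulr0.
Qed.

Lemma drho_Lsph_integrand j z :
  rho z `^ (2 - Q) *
    `|drho (fun z' => rho z' `^ ((Q - 2) / 2) * Lsph j u z') z| ^+ 2 =
  mixed_part j z.
Proof.
have [Kz|Kz] := pselect (K z).
  by apply: drho_powR_Lsph_sqr => //; exact: KA.
rewrite (vanishes_drho clK _ Kz); last first.
  by move=> x Kx; rewrite (vanishes_Lsph clK j u0)// mulr0.
rewrite normr0 expr0n/= mulr0 /mixed_part (vanishes_euler clK (vanishes_tang clK j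
  u0))//.
by rewrite (vanishes_tang clK j u0)// mulr0 addr0 expr0n/= mulr0.
Qed.

End rellich_integrals.

Theorem theorem1p4 (R : realType) (n : nat) (hn : (2 <= n)%N)
    (u : 'rV[R]_n * R -> R) (hu : test_function u) :
  let Q : R := hdim R n in
  (integral_space (fun z => `|LG u z| ^+ 2 / enorm1 (gradG rho z) ^+ 2)%R =
   integral_space (fun z => `|LrhoG u z| ^+ 2 / enorm1 (gradG rho z) ^+ 2)%R
   + integral_space (fun z =>
       `|\sum_(j < n.+1) Lsph j (Lsph j u) z| ^+ 2
         / enorm1 (gradG rho z) ^+ 2)%R
   + (Q * (Q - 4) / 2)%:E
     * \sum_(j < n.+1)
         integral_space (fun z => `|Lsph j u z| ^+ 2 / rho z ^+ 2)%R
   + 2%:E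
     * \sum_(j < n.+1)
         integral_space (fun z =>
           rho z `^ (2 - Q)
           * `|drho (fun z' => rho z' `^ ((Q - 2) / 2) * Lsph j u z') z| ^+ 2)%R)%E.
Proof.
move=> Q.
(* The integrands agree at every point, including the origin and [x = 0], so they can be replaced as
   functions. *)
rewrite (funext (LG_integrand hu)) (funext (LrhoG_integrand hu)).
rewrite (funext (spherical_integrand hu)) (integral_identity hn hu).
congr (_ + _ * _ + _ * _)%E; apply: eq_bigr => j _.
  by rewrite (funext (Lsph_integrand hu j)).
by rewrite (funext (drho_Lsph_integrand hu j)).
Qed.
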